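(* Fix $0<\rho<2$, $C>0$ and $r>\rho$. For $a,b\in\mathcal K_\rho(C)$ and $n\ge1$, $$d_r(a,b)\le C\,H_n(a,b)^{1-\rho/r},\qquad q_n(a,b)\le2(2n+1)S_\rho\Big(\frac{\|a-b\|_\infty}{C}\Big)^{1-\rho/2}.$$ The full elementary-coefficient map $J(a)=(E_k(a))_{k\ge1}$ is a uniform isomorphism of $\mathcal K_\rho(C)$ (with the uniformity induced by $d_r$) onto its image (with the coordinate product uniformity). The class $\mathcal K_\rho(C)$ is compact and complete for the uniformity induced by $d_r$, and $$\widehat{\mathcal K_\rho^{\rm fin}(C)}^{\,d_r}\simeq\mathcal K_\rho(C)\xrightarrow[\ J\ ]{\simeq}\overline{J(\mathcal K_\rho^{\rm fin}(C))}^{\,\rm coord},$$ i.e. the $d_r$-completion of the finite spectra is $\mathcal K_\rho(C)$, and $J$ maps it onto the coordinatewise closure of $J(\mathcal K^{\rm fin}_\rho(C))$. For every $p\ge1$ with $p>\rho$, the same coordinate topology is also the $\ell^p$ topology of the sequences, and $$\|a-b\|_{\ell^p}\le\Big(\frac p{p-\rho}\Big)^{1/p}C\,H_n(a,b)^{1-\rho/p}.$$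
   Context: $\mathcal K_\rho(C)=\{a_1\ge a_2\ge\cdots\ge0:\ a_j\le Cj^{-1/\rho}\ \forall j\}$; $\mathcal K_\rho^{\rm fin}(C)$ is the subset of finitely supported sequences. $E_k(a)=e_k(x)$ is the $k$-th elementary symmetric function of $x_j=(a_j/C)^2$. $d_r(a,b)=\sup_{k\ge1}k^{1/r}(|a-b|)^*_k$, where $(|a-b|)^*$ is the decreasing rearrangement of $(|a_j-b_j|)_j$ (a quasi-distance, defining a translation-invariant uniformity). For $a,b\in\mathcal K_\rho(C)$ with $x_j=(a_j/C)^2$, $y_j=(b_j/C)^2$: $\mu_x=\sum_jx_j\delta_{x_j}$, $\beta_{k,n}(x)=\int\binom nkt^k(1-t)^{n-k}\,d\mu_x(t)$, $q_n(a,b)=\sum_{k=0}^n|\beta_{k,n}(x)-\beta_{k,n}(y)|$, $S_\rho=2/(2-\rho)$, $H_n(a,b)=\min\{1,(q_n(a,b)+4S_\rho/\sqrt n)^{1/4}\}$. (The sequence $a$ represents the positive block singular values of a real skew-adjoint Hilbert--Schmidt operator, zeros appended.) *)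

(* Defs.v *)
From HB Require Import structures.
From mathcomp Require Import all_boot all_order all_algebra finmap.
From mathcomp Require Import all_classical all_reals all_analysis.
From mathcomp Require Import ring.

Set Implicit Arguments.
Unset Strict Implicit.
Unset Printing Implicit Defensive.

Import Order.TTheory GRing.Theory Num.Theory.
Import numFieldNormedType.Exports.

Local Open Scope classical_set_scope.
Local Open Scope ring_scope.

Section UniformSpaces.
Implicit Types X Y : uniformType.

Definition unif_iso X Y (f : X -> Y) : Prop :=
  exists g : Y -> X,
    [/\ cancel f g, cancel g f, unif_continuous f & unif_continuous g].

(* [B] carries the uniformity induced by [Y]. *)
Definition unif_iso_onto X Y (f : X -> Y) (B : set Y) : Prop :=
  exists2 g : X -> set_type B, (forall x, set_val (g x) = f x) & unif_iso g.

(* The library's [completeType] axiom, without its pointedness requirement. *)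
Definition complete_space X : Prop :=
  forall F : set_system X, ProperFilter F -> cauchy F ->
    exists x : X, F --> x.

Definition is_completion X Y (i : X -> Y) : Prop :=
  [/\ complete_space Y, hausdorff_space Y,
      unif_iso_onto i (range i) & dense (range i)].

End UniformSpaces.

(* Quasi-distances are allowed to take the value +oo. *)
Record quasi_dist (R : realType) (T : choiceType) := QuasiDist {
  qdist :> T -> T -> \bar R;
  qdist_ge0 : forall x y, (0 <= qdist x y)%E;
  qdist_refl : forall x, qdist x x = 0%E;
  qdist_sym : forall x y, qdist x y = qdist y x;
  qdist_triangle : exists2 M : R, 0 < M &
    forall x y z, (qdist x z <= M%:E * (qdist x y + qdist y z))%E }.

Definition qdist_space (R : realType) (T : choiceType)
  (q : quasi_dist R T) : Type := T.

Section QuasiDistUniformity.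
Local Open Scope relation_scope.
Context (R : realType) (T : choiceType) (q : quasi_dist R T).
Local Notation M := (qdist_space q).

Definition qdist_entourage : set_system (M * M) :=
  filter_from [set e : R | 0 < e] (fun e => [set xy | (q xy.1 xy.2 < e%:E)%E]).

Let ent_filter : Filter qdist_entourage.
Proof.
apply: filter_from_filter; first by exists 1; exact: ltr01.
move=> e f /= e0 f0; exists (Num.min e f) => /=; first by rewrite lt_min e0.
by move=> xy /= h; split=> /=; apply: (lt_le_trans h);
  rewrite lee_fin ge_min lexx ?orbT.
Qed.

Let ent_diagonal A : qdist_entourage A -> diagonal `<=` A.
Proof.
move=> [e /= e0 eA] [x y] /diagonalP ->; apply: eA => /=.
by rewrite qdist_refl lte_fin.
Qed.

Let ent_inv A : qdist_entourage A -> qdist_entourage A^-1.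
Proof.
move=> [e /= e0 eA]; exists e => //= -[x y] /= h.
by apply: eA => /=; rewrite qdist_sym.
Qed.

Let ent_split A : qdist_entourage A ->
  exists2 B, qdist_entourage B & B \; B `<=` A.
Proof.
move=> [e /= e0 eA]; have [c c0 tri] := qdist_triangle q.
pose d := e / (c * 2).
have d0 : 0 < d by rewrite divr_gt0 // mulr_gt0.
exists [set xy | (q xy.1 xy.2 < d%:E)%E]; first by exists d.
move=> [x z] [y /= xy yz]; apply: eA => /=.
apply: (le_lt_trans (tri x y z)).
have -> : e%:E = (c%:E * (d%:E + d%:E))%E.
  by rewrite -EFinD -EFinM /d; congr EFin; field; rewrite gt_eqF.
by rewrite lte_pmul2l // lteD.
Qed.

HB.instance Definition _ := Choice.on M.
HB.instance Definition _ := isUniform.Build M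
  ent_filter ent_diagonal ent_inv ent_split.

End QuasiDistUniformity.

(* Sequences are indexed from 0: [a j] is the paper's $a_{j+1}$. *)
Section Spectra.
Context {R : realType}.
Implicit Types (rho C r p : R) (a b c : nat -> R) (n k : nat).

Definition spectra rho C : set (nat -> R) :=
  [set a : nat -> R | [/\ nonincreasing_seq a, forall j, 0 <= a j &
               forall j, a j <= C * j.+1%:R `^ (- rho^-1)]].

Definition fin_spectra rho C : set (nat -> R) :=
  spectra rho C `&` [set a : nat -> R | finite_set [set j | a j != 0]].

Definition sqvar C a : nat -> R := fun j => (a j / C) ^+ 2.

Definition elem_sym k (x : nat -> R) : R :=
  fine (\esum_(A in [set A : {fset nat} | #|` A| = k])
          (\prod_(j <- A) x j)%:E).

(* The coordinate of index [k] is $E_{k+1}$. *)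
Definition elem_coefs C a : {ptws nat -> R} :=
  fun k => elem_sym k.+1 (sqvar C a).

Definition spectral_measure C a :
    {measure set R -> \bar R} :=
  mseries (fun j => mscale (NngNum (sqr_ge0 (a j / C))) (\d_(sqvar C a j))) 0.

Definition bernstein_moment C n k a : R :=
  \int[spectral_measure C a]_(t in setT)
    ('C(n, k)%:R * t ^+ k * (1 - t) ^+ (n - k)).

Definition qn C n a b : R :=
  \sum_(k < n.+1) `|bernstein_moment C n k a - bernstein_moment C n k b|.

Definition S_ rho : R := 2 / (2 - rho).

Definition Hn rho C n a b : R :=
  Num.min 1 ((qn C n a b + 4 * S_ rho / Num.sqrt n%:R) `^ (1 / 4)).

(* $c^*_{k+1} = \inf\{t\ge 0 : \#\{j : |c_j|>t\}\le k\}$, with value +oo if no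
   such [t] exists. *)
Definition decr_rearr c k : \bar R :=
  ereal_inf [set t%:E | t in
    [set t : R | 0 <= t /\ ([set j | (t < `|c j|)%R] #<= `I_k)%card]].

Definition weak_dist r a b : \bar R :=
  ereal_sup (range (fun k =>
    ((k.+1%:R `^ r^-1)%:E * decr_rearr (fun j => (a j - b j)%R) k)%E)).

Definition lp_dist p a b : \bar R :=
  (Lnorm counting p%:E (fun j : nat => (a j - b j)%:E))%E.

Definition sup_dist a b : R := sup (range (fun j => `|a j - b j|)).

End Spectra.

Section QuasiDistances.
Context {R : realType}.

Let card_fset_le (T : choiceType) (A : set T) n :
  (A #<= `I_n)%card -> exists2 F : {fset T}, A = [set` F] & (#|` F| <= n)%N.
Proof.
move=> An; have finA : finite_set A by apply/finite_set_leP; exists n.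
have /finite_setP[m Am] := finA.
exists (fset_set A); first by rewrite fset_setK.
by rewrite (card_fset_set Am) -card_le_II -(card_le_eql Am).
Qed.

Let card_leU (A B : set nat) k l :
  (A #<= `I_k)%card -> (B #<= `I_l)%card -> (A `|` B #<= `I_(k + l))%card.
Proof.
move=> /card_fset_le[F -> Fk] /card_fset_le[G -> Gl].
have -> : [set` F] `|` [set` G] = [set` (F `|` G)%fset] by rewrite set_fsetU.
have fin : finite_set [set` (F `|` G)%fset] by exact: finite_fset.
have /finite_setP[m Am] := fin.
rewrite (card_le_eql Am) card_le_II -(card_fset_set Am) set_fsetK.
by apply: leq_trans (leq_add Fk Gl); rewrite cardfsU leq_subr.
Qed.

Let decr_rearr_ge0 (c : nat -> R) k : (0 <= decr_rearr c k)%E.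
Proof.
by apply: le_ereal_inf_tmp => _ [t [t0 _] <-]; rewrite lee_fin.
Qed.

Let decr_rearr_add (c d : nat -> R) k l m : (k + l <= m)%N ->
  (decr_rearr (fun j => (c j + d j)%R) m <= decr_rearr c k + decr_rearr d l)%E.
Proof.
move=> klm.
have [/eqP->|] := boolP (decr_rearr c k == +oo%E).
  by rewrite addye ?leey // -ltNye (lt_le_trans _ (decr_rearr_ge0 _ _)).
rewrite -ltey => cfin.
have [/eqP->|] := boolP (decr_rearr d l == +oo%E).
  by rewrite addey ?leey // -ltNye (lt_le_trans _ (decr_rearr_ge0 _ _)).
rewrite -ltey => dfin.
have {}cfin : decr_rearr c k \is a fin_num by rewrite ge0_fin_numE.
have {}dfin : decr_rearr d l \is a fin_num by rewrite ge0_fin_numE.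
apply/lee_addgt0Pr => e e0; have e20 : 0 < e / 2 by rewrite divr_gt0.
have [_ [s [s0 cs] <-] sk] := lb_ereal_inf_adherent e20 cfin.
have [_ [t [t0 dt] <-] tl] := lb_ereal_inf_adherent e20 dfin.
have -> : e%:E = ((e / 2)%:E + (e / 2)%:E)%E.
  by rewrite -EFinD; congr EFin; field.
rewrite addeACA; apply: (@le_trans _ _ (s%:E + t%:E)%E); last first.
  by apply: leeD; exact: ltW.
apply: ereal_inf_lbound; exists (s + t) => //; split; first exact: addr_ge0.
have : ([set j | s < `|c j|] `|` [set j | t < `|d j|] #<= `I_m)%card.
  by apply: card_le_trans (card_leU cs dt) _; rewrite card_le_II.
apply: card_le_trans; apply: subset_card_le => j /= stj.
have [cj|cj] := ltP s `|c j|; [by left|right].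
rewrite ltNge; apply/negP => dj; move: stj; rewrite ltNge => /negP; apply.
exact: le_trans (ler_normD _ _) (lerD cj dj).
Qed.

Let weak_dist_ge0 r (a b : nat -> R) : (0 <= weak_dist r a b)%E.
Proof.
apply: le_ereal_sup_tmp; exists ((1%:R `^ r^-1)%:E *
  decr_rearr (fun j => (a j - b j)%R) 0)%E; first by exists 0%N.
by rewrite mule_ge0 // lee_fin powR_ge0.
Qed.

Let weak_dist_refl r (a : nat -> R) : weak_dist r a a = 0%E.
Proof.
apply/eqP; rewrite eq_le weak_dist_ge0 andbT.
apply: ge_ereal_sup => _ [k _ <-].
suff -> : decr_rearr (fun j => a j - a j) k = 0%E by rewrite mule0.
apply/eqP; rewrite eq_le decr_rearr_ge0 andbT.
apply: ereal_inf_lbound; exists 0 => //; split => //.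
rewrite [X in (X #<= _)%card](_ : _ = set0) ?card_ge0 //.
by apply/seteqP; split=> // j /=; rewrite subrr normr0 ltxx.
Qed.

Let weak_dist_sym r (a b : nat -> R) : weak_dist r a b = weak_dist r b a.
Proof.
rewrite /weak_dist; suff -> : (fun j => a j - b j) = (fun j => - (b j - a j)).
  rewrite /decr_rearr; congr ereal_sup; apply: eq_imagel => k _ /=.
  congr (_ * ereal_inf _)%E; congr image; apply/funext => t.
  congr (_ /\ is_true (_ #<= _)%card).
  by apply/funext => j /=; rewrite normrN.
by apply/funext => j; rewrite opprB.
Qed.

Let weak_dist_triangle r : 0 < r -> exists2 M : R, 0 < M &
  forall a b c : nat -> R, (weak_dist r a c <=
    M%:E * (weak_dist r a b + weak_dist r b c))%E.
Proof.
move=> r0; exists (2 `^ r^-1); first by rewrite powR_gt0.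
move=> a b c; apply: ge_ereal_sup => _ [m _ <-].
set k := m./2.
have -> : (fun j => a j - c j) = (fun j => (a j - b j) + (b j - c j)).
  by apply/funext => j; rewrite addrA subrK.
have kkm : (k + k <= m)%N by rewrite addnn -[leqRHS](odd_double_half m) leq_addl.
apply: (@le_trans _ _ ((2 `^ r^-1)%:E * ((k.+1%:R `^ r^-1)%:E *
  (decr_rearr (fun j => (a j - b j)%R) k +
   decr_rearr (fun j => (b j - c j)%R) k)))%E).
  rewrite muleA; apply: lee_pmul => //.
  - rewrite -EFinM lee_fin -powRM //; apply: ge0_ler_powR.
    + by rewrite invr_ge0 ltW.
    + by rewrite nnegrE.
    + by rewrite nnegrE mulr_ge0.
    + rewrite -natrM ler_nat mul2n -[in leqLHS](odd_double_half m) -/k.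
      by rewrite doubleS ltnS; case: (odd m); rewrite ?add1n ?add0n.
  - exact: decr_rearr_add.
rewrite lee_pmul2l ?lte_fin ?powR_gt0 //.
rewrite ge0_muleDr //; apply: leeD; apply: ereal_sup_ubound.
- by exists k.
- by exists k.
Qed.

Definition weak_qdist r (r0 : 0 < r) : quasi_dist R (nat -> R) :=
  QuasiDist (weak_dist_ge0 r) (weak_dist_refl r) (weak_dist_sym r)
    (weak_dist_triangle r0).

Let lp_dist_ge0 p (a b : nat -> R) : (0 <= lp_dist p a b)%E.
Proof. exact: Lnorm_ge0. Qed.

Let lp_dist_refl p : 1 <= p -> forall a : nat -> R, lp_dist p a a = 0%E.
Proof.
move=> p1 a; have p0 : 0 < p by exact: lt_le_trans p1.
rewrite /lp_dist Lnorm_counting // eseries0 => [|j _ _].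
  by rewrite poweR0r // invr_neq0 // gt_eqF.
by rewrite subrr abse0 poweR0r // gt_eqF.
Qed.

Let lp_dist_sym p (a b : nat -> R) : lp_dist p a b = lp_dist p b a.
Proof.
rewrite /lp_dist -oppe_Lnorm; apply: eq_Lnorm => j /=.
by rewrite opprB.
Qed.

Let lp_dist_triangle p : 1 <= p -> exists2 M : R, 0 < M &
  forall a b c : nat -> R, (lp_dist p a c <=
    M%:E * (lp_dist p a b + lp_dist p b c))%E.
Proof.
move=> p1; exists 1 => // a b c; rewrite mul1e.
have -> : lp_dist p a c = ('N[counting]_(p%:E)[EFin \o
    ((fun j : nat => (a j - b j)%R) \+ (fun j => (b j - c j)%R))%R])%E.
  by apply: eq_Lnorm => j /=; rewrite addrA subrK.
exact: minkowski_EFin.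
Qed.

Definition lp_qdist p (p1 : 1 <= p) : quasi_dist R (nat -> R) :=
  QuasiDist (lp_dist_ge0 p) (lp_dist_refl p1) (lp_dist_sym p)
    (lp_dist_triangle p1).

End QuasiDistances.

(* Main.v *)
Require Import Defs.
From HB Require Import structures.
From mathcomp Require Import all_boot all_order all_algebra finmap.
From mathcomp Require Import all_classical all_reals all_analysis.
From mathcomp Require Import measurable_realfun ring lra.

Import Order.TTheory GRing.Theory Num.Theory.
Import numFieldNormedType.Exports.

Local Open Scope classical_set_scope.
Local Open Scope ring_scope.

(** Write x_j = (a_j / C)^2 and y_j = (b_j / C)^2.  The decay of the class puts
    x_j in [0, 1] and gives sum_j x_j <= S_rho, so every integral against mu_x
    is a series that converges at a rate uniform over the class.

    The whole statement rests on one comparison: each of the data at hand (the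
    weak distance d_r, the l^p distance, the numbers q_n, the coefficients E_k)
    controls, uniformly over the class, the supremum distance
    eta = sup_j |a_j - b_j| / C, and conversely.

    From q_n to eta ([moment_gap], [dist_le_Hn]).  Suppose y_m < x_m, with gap
    d.  A function f which makes t f(t) equal to 0 for t <= y_m, at least 1 for
    t >= x_m and at most 1 everywhere counts terms: since the sequences
    decrease, its integrals against mu_x and mu_y differ by at least 1.  It may
    be taken bounded by 1/d and Lipschitz with constant 4/d^2.  Replacing f by
    its Bernstein polynomial of degree n costs (4/d^2) S_rho / (2 sqrt n) for
    each measure, and the polynomial itself only sees the Bernstein moments.
    Hence d^2 <= q_n + 4 S_rho / sqrt n, and (|a_m - b_m| / C)^4 <= d^2.

    From eta to q_n ([qn_le]).  The polynomials t binom(n,k) t^k (1-t)^(n-k)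
    have values at s and t whose distances add up, over k, to at most
    (2n+1)|s-t|, and sum_j |x_j - y_j| is at most 2 S_rho eta^(1-rho/2) by Cauchy-Schwarz and a
    sum of powers of min(eta, j^(-1/rho)) ([sum_powR_le]).

    From eta to d_r and l^p ([weak_dist_le], [lp_dist_le]).  Interpolate between
    |a_j - b_j| <= C eta and |a_j - b_j| <= C j^(-1/rho).

    Between eta and the coefficients.  E_k is Lipschitz for the l^1 distance of
    x and y ([esym_lipschitz]).  Conversely Newton's identities make the power
    sums, hence the Bernstein moments, Lipschitz functions of E_1, ..., E_(n+1)
    ([moment_dist_esym]), after which the estimate of eta by q_n with n large
    recovers eta ([elem_coefs_inverse_modulus]); injectivity of J is the case
    of equal coefficients.

    Consequently the uniformities induced by d_r, by l^p and by J on the class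
    all coincide with that of the supremum distance ([weak_entourageP],
    [lp_entourageP], [coefs_entourageP]).  Because the tails are uniformly
    small, that uniformity is also the one of pointwise convergence, so the
    class is compact ([spectra_compact]) and truncation makes the finitely
    supported sequences dense.  Completeness and the description of the closure
    of J(K^fin) as the compact set J(K) follow. *)

Set Implicit Arguments.
Unset Strict Implicit.

(** * Sums of powers *)

Lemma gt0_powRD (R : realType) (x r s : R) : 0 < x ->
  x `^ (r + s) = x `^ r * x `^ s.
Proof. by move=> x0; rewrite powRD // (gt_eqF x0) implybT. Qed.

(** The graph of the convex function v |-> v^(1-s) lies above its tangent at
    u; after rescaling this is ln t <= t - 1. *)
Lemma powR_tangent (R : realType) (s u v : R) : 1 <= s -> 0 < u -> 0 < v ->
  u `^ (1 - s) + (s - 1) * (u `^ (- s) * (u - v)) <= v `^ (1 - s).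
Proof.
move=> s1 u0 v0; pose t := v / u; have t0 : 0 < t by rewrite divr_gt0.
have vE : v = u * t by rewrite /t mulrC divfK ?gt_eqF.
have u1s : u `^ (1 - s) = u * u `^ (- s).
  by rewrite gt0_powRD // powRr1 // ltW.
have ht : 1 + (1 - s) * (t - 1) <= t `^ (1 - s).
  rewrite /powR gt_eqF //; apply: le_trans (expR_ge1Dx _).
  rewrite lerD2l; apply: ler_wnM2l; first by rewrite subr_le0.
  by rewrite -[X in ln X](subrKC 1 t); apply: le_ln1Dx; lra.
rewrite [in leRHS]vE powRM ?(ltW u0) ?(ltW t0) // u1s vE.
have h0 : 0 <= u * u `^ (- s) by rewrite mulr_ge0 ?powR_ge0 ?ltW.
have := ler_wpM2l h0 ht; lra.
Qed.

(** The bound is the integral over (0, +oo) of the nonincreasing function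
    max(t, N)^(-s), computed exactly. The proof telescopes [Phi], the convex
    function with derivative - max(t, N)^(-s), so that no integral appears and
    N need not be an integer. *)
Lemma sum_powR_max (R : realType) (s N : R) (m : nat) : 1 < s -> 0 < N ->
  \sum_(j < m) Num.max j.+1%:R N `^ (- s) <= s / (s - 1) * N `^ (1 - s).
Proof.
move=> s1 N0; have s10 : 0 < s - 1 by rewrite subr_gt0.
pose M (j : nat) := Num.max j%:R N.
have M0 j : 0 < M j by rewrite /M lt_max N0 orbT.
pose Phi (j : nat) := M j `^ (1 - s) / (s - 1) + (M j - j%:R) * M j `^ (- s).
have step j : M j.+1 `^ (- s) <= Phi j - Phi j.+1.
  have MS : M j <= M j.+1 by rewrite /M le_max2 // ler_nat.
  have Mj : j%:R <= M j by rewrite /M le_max lexx.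
  have Ms : M j.+1 `^ (- s) <= M j `^ (- s).
    by rewrite !powRN lef_pV2 ?posrE ?powR_gt0 // ge0_ler_powR // ?nnegrE ?ltW //;
      lra.
  have tan := powR_tangent (ltW s1) (M0 j.+1) (M0 j).
  have {}tan : M j.+1 `^ (1 - s) / (s - 1) + M j.+1 `^ (- s) * (M j.+1 - M j)
      <= M j `^ (1 - s) / (s - 1).
    rewrite ler_pdivlMr //; apply: le_trans tan.
    rewrite le_eqVlt; apply/orP; left; apply/eqP.
    by field; rewrite gt_eqF.
  have := ler_wpM2l (_ : 0 <= M j - j%:R) Ms; rewrite subr_ge0 => /(_ Mj).
  rewrite /Phi -[j.+1%:R]natr1; lra.
have -> : s / (s - 1) * N `^ (1 - s) = Phi 0.
  have M0E : M 0 = N by rewrite /M max_r // ltW.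
  have -> : Phi 0 = N `^ (1 - s) / (s - 1) + N * N `^ (- s).
    by rewrite /Phi M0E subr0.
  have -> : N * N `^ (- s) = N `^ (1 - s).
    by rewrite gt0_powRD // powRr1 // ltW.
  by field; rewrite gt_eqF.
have Phi0 j : 0 <= Phi j.
  rewrite /Phi addr_ge0 // ?divr_ge0 ?powR_ge0 ?(ltW s10) //.
  by rewrite mulr_ge0 ?powR_ge0 // subr_ge0 /M le_max lexx.
suff : \sum_(j < m) M j.+1 `^ (- s) <= Phi 0 - Phi m.
  by move/le_trans; apply; rewrite gerBl.
elim: m => [|m IH]; first by rewrite big_ord0 subrr.
by rewrite big_ord_recr /=; have := step m; lra.
Qed.

(** * Bernstein polynomials *)

Definition bern (R : realType) (n k : nat) (t : R) : R :=
  'C(n, k)%:R * t ^+ k * (1 - t) ^+ (n - k).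

Lemma bern_ge0 (R : realType) n k (t : R) : 0 <= t <= 1 -> 0 <= bern n k t.
Proof.
case/andP=> t0 t1.
by rewrite /bern !mulr_ge0 // exprn_ge0 // subr_ge0.
Qed.

Lemma bern_small (R : realType) n k (t : R) : (n < k)%N -> bern n k t = 0.
Proof. by move=> nk; rewrite /bern bin_small // !mul0r. Qed.

Lemma bernS (R : realType) n k (t : R) :
  bern n.+1 k.+1 t = t * bern n k t + (1 - t) * bern n k.+1 t.
Proof.
rewrite /bern binS natrD subSS.
have [kn|nk] := ltnP k n.
  by rewrite -(subnSK kn) !exprS; ring.
by rewrite ['C(n, k.+1)]bin_small ?ltnS // exprS; ring.
Qed.

(** One step of the Bernoulli walk: a binomial variable of size n.+1 is one of
    size n plus an independent Bernoulli variable. All the properties of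
    Bernstein polynomials below are inductions on n through this identity. *)
Lemma bern_sumS (R : realType) n (t : R) (g : nat -> R) :
  \sum_(k < n.+2) bern n.+1 k t * g k =
  \sum_(k < n.+1) bern n k t * ((1 - t) * g k + t * g k.+1).
Proof.
rewrite big_ord_recl.
under eq_bigr do rewrite /bump /= ?add1n bernS mulrDl.
rewrite big_split /= addrA addrAC.
under [RHS]eq_bigr do rewrite mulrDr.
rewrite [RHS]big_split /=; congr (_ + _); last first.
  by apply: eq_bigr => k _; ring.
rewrite big_ord_recr /= (bern_small t (ltnSn n)) mulr0 mul0r addr0.
rewrite [RHS]big_ord_recl.
congr (_ + _); first by rewrite /bern !subn0 !bin0 exprS; ring.
by apply: eq_bigr => k _; rewrite /bump /= ?add1n; ring.
Qed.

Lemma bern_sum0 (R : realType) (t : R) (g : nat -> R) :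
  \sum_(k < 1) bern 0 k t * g k = g 0.
Proof. by rewrite big_ord1 /bern bin0 !expr0 !mul1r. Qed.

Lemma bern_sum1 (R : realType) n (t : R) : \sum_(k < n.+1) bern n k t = 1.
Proof.
have H m : \sum_(k < m.+1) bern m k t * 1 = 1.
  elim: m => [|m IH]; first by rewrite (bern_sum0 t (fun=> 1)).
  rewrite (bern_sumS _ _ (fun=> 1)) -[RHS]IH.
  by apply: eq_bigr => k _; ring.
by rewrite -[RHS](H n); apply: eq_bigr => k _; rewrite mulr1.
Qed.

Lemma bern_variance (R : realType) n (t : R) :
  \sum_(k < n.+1) bern n k t * (k%:R - n%:R * t) ^+ 2 = n%:R * t * (1 - t).
Proof.
elim: n => [|n IH].
  by rewrite (bern_sum0 t (fun k => (k%:R - 0%:R * t) ^+ 2)); ring.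
rewrite (bern_sumS _ _ (fun k => (k%:R - n.+1%:R * t) ^+ 2)).
have -> : n.+1%:R * t * (1 - t) =
    n%:R * t * (1 - t) + t * (1 - t) * \sum_(k < n.+1) bern n k t.
  by rewrite bern_sum1 -natr1; ring.
rewrite mulr_sumr -IH -big_split /=.
by apply: eq_bigr => k _; rewrite -!natr1; ring.
Qed.

(** Total variation distance between two binomial laws, in dual form: testing
    against an arbitrary g bounded by 1 makes the induction on n go through,
    since the step of [bern_sumS] preserves that bound. *)
Lemma bern_sum_lipschitz (R : realType) n (x y : R) (g : nat -> R) :
  0 <= x <= 1 -> 0 <= y <= 1 -> (forall k, `|g k| <= 1) ->
  `|\sum_(k < n.+1) bern n k x * g k - \sum_(k < n.+1) bern n k y * g k|
    <= 2 * n%:R * `|x - y|.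
Proof.
move=> x01 y01; elim: n g => [|n IH] g g1.
  by rewrite !bern_sum0 subrr normr0 mulr0 mul0r.
rewrite !bern_sumS.
have -> : \sum_(k < n.+1) bern n k x * ((1 - x) * g k + x * g k.+1) =
    \sum_(k < n.+1) bern n k x * ((1 - y) * g k + y * g k.+1) +
    (x - y) * \sum_(k < n.+1) bern n k x * (g k.+1 - g k).
  by rewrite mulr_sumr -big_split; apply: eq_bigr => k _ /=; ring.
rewrite addrAC; apply: le_trans (ler_normD _ _) _.
have -> : 2 * n.+1%:R * `|x - y| = 2 * n%:R * `|x - y| + `|x - y| * 2.
  by rewrite -natr1; ring.
apply: lerD.
  apply: (IH (fun k => (1 - y) * g k + y * g k.+1)) => k.
  apply: le_trans (ler_normD _ _) _; case/andP: y01 => y0 y1.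
  have y1' : 0 <= 1 - y by rewrite subr_ge0.
  rewrite !normrM (ger0_norm y0) (ger0_norm y1').
  have := ler_wpM2l y1' (g1 k); have := ler_wpM2l y0 (g1 k.+1); lra.
rewrite normrM; apply: ler_wpM2l => //.
have -> : 2 = \sum_(k < n.+1) 2 * bern n k x.
  by rewrite -mulr_sumr bern_sum1 mulr1.
apply: le_trans (ler_norm_sum _ _ _) _; apply: ler_sum => k _.
rewrite normrM ger0_norm ?bern_ge0 // mulrC; apply: ler_wpM2r.
  exact: bern_ge0.
by apply: le_trans (ler_normB _ _) _; have := g1 k; have := g1 k.+1; lra.
Qed.

Lemma bern_variation (R : realType) n (x y : R) :
  0 <= x <= 1 -> 0 <= y <= 1 ->
  \sum_(k < n.+1) `|bern n k x - bern n k y| <= 2 * n%:R * `|x - y|.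
Proof.
move=> x01 y01; pose g k := Num.sg (bern n k x - bern n k y).
have g1 k : `|g k| <= 1 by rewrite normr_sg lern1 leq_b1.
apply: le_trans (bern_sum_lipschitz n x01 y01 g1).
rewrite -sumrB; apply: le_trans (ler_norm _); apply: ler_sum => k _.
by rewrite normrEsg -mulrBl mulrC.
Qed.

(** The expectation of |X/n - t| for a binomial variable X of parameters n and
    t is at most 1 / (2 sqrt n), because its variance t(1-t)/n is at most 1 /
    (4n). *)
Lemma bern_approx (R : realType) n (L t : R) (f : R -> R) :
  (0 < n)%N -> 0 <= L -> 0 <= t <= 1 ->
  (forall u v, `|f u - f v| <= L * `|u - v|) ->
  `|f t - \sum_(k < n.+1) bern n k t * f (k%:R / n%:R)|
    <= L / (2 * Num.sqrt n%:R).
Proof.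
move=> n0 L0 t01 fL; have n0' : 0 < n%:R :> R by rewrite ltr0n.
pose q := Num.sqrt n%:R : R.
have q0 : 0 < q by rewrite sqrtr_gt0.
have q2 : n%:R = q ^+ 2 by rewrite sqr_sqrtr // ltW.
have E : f t = \sum_(k < n.+1) bern n k t * f t.
  by rewrite -mulr_suml bern_sum1 mul1r.
rewrite {1}E -sumrB; apply: le_trans (ler_norm_sum _ _ _) _.
(* |u| <= q u^2 + 1 / (4 q) turns the variance into a first moment bound *)
apply: (@le_trans _ _ (\sum_(k < n.+1) (bern n k t *
    (L / q * (q ^- 2 * (k%:R - n%:R * t) ^+ 2 + 4^-1))))).
  apply: ler_sum => k _; rewrite -mulrBr normrM ger0_norm ?bern_ge0 //.
  apply: ler_wpM2l; first exact: bern_ge0.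
  apply: le_trans (fL _ _) _; rewrite -mulrA; apply: ler_wpM2l => //.
  rewrite q2; set w := t - _.
  have -> : q ^- 2 * (k%:R - q ^+ 2 * t) ^+ 2 = (q * `|w|) ^+ 2.
    rewrite exprMn real_normK ?num_real // /w; field.
    by rewrite gt_eqF.
  rewrite ler_pdivlMl //.
  by have := sqr_ge0 (q * `|w| - 2^-1); lra.
have -> : \sum_(k < n.+1) bern n k t *
    (L / q * (q ^- 2 * (k%:R - n%:R * t) ^+ 2 + 4^-1)) =
  L / q * (q ^- 2 * \sum_(k < n.+1) bern n k t * (k%:R - n%:R * t) ^+ 2 +
    4^-1 * \sum_(k < n.+1) bern n k t).
  rewrite mulr_sumr [X in _ + X]mulr_sumr -big_split mulr_sumr /=.
  by apply: eq_bigr => k _; ring.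
rewrite bern_variance bern_sum1.
have -> : L / (2 * Num.sqrt n%:R) = L / q * 2^-1 by rewrite invfM mulrCA mulrC.
apply: ler_wpM2l; first by rewrite divr_ge0 // ltW.
have -> : q ^- 2 * (n%:R * t * (1 - t)) = t * (1 - t).
  by rewrite q2; field; rewrite gt_eqF.
by have := sqr_ge0 (t - 2^-1); lra.
Qed.

(** * Separating two sequences by their Bernstein moments *)

Definition moment_sum (R : realType) (n k N : nat) (x : nat -> R) : R :=
  \sum_(j < N) x j * bern n k (x j).

(** The quantity q_n for the sequences truncated at rank N. *)
Definition moment_dist (R : realType) (n N : nat) (x y : nat -> R) : R :=
  \sum_(k < n.+1) `|moment_sum n k N x - moment_sum n k N y|.

Lemma moment_dist_ge0 (R : realType) (n N : nat) (x y : nat -> R) :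
  0 <= moment_dist n N x y.
Proof. exact: sumr_ge0. Qed.

Lemma moment_dist_sym (R : realType) (n N : nat) (x y : nat -> R) :
  moment_dist n N x y = moment_dist n N y x.
Proof. by apply: eq_bigr => k _; rewrite distrC. Qed.

(** Replace f by its Bernstein polynomial: the polynomial pairs with the
    moments, and the error is at most L / (2 sqrt n) against each measure. *)
Lemma moment_pairing (R : realType) (n N : nat) (F L S : R) (x y : nat -> R)
    (f : R -> R) :
  (0 < n)%N -> 0 <= L ->
  (forall j, 0 <= x j <= 1) -> (forall j, 0 <= y j <= 1) ->
  \sum_(j < N) x j <= S -> \sum_(j < N) y j <= S ->
  (forall u v, `|f u - f v| <= L * `|u - v|) -> (forall u, `|f u| <= F) ->
  \sum_(j < N) x j * f (x j) - \sum_(j < N) y j * f (y j) <=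
    F * moment_dist n N x y + L * S / Num.sqrt n%:R.
Proof.
move=> n0 L0 x01 y01 xS yS fL fF.
pose q := Num.sqrt n%:R : R.
have q0 : 0 < q by rewrite sqrtr_gt0 ltr0n.
pose Bf t := \sum_(k < n.+1) bern n k t * f (k%:R / n%:R).
have approx (z : nat -> R) :
    (forall j, 0 <= z j <= 1) -> \sum_(j < N) z j <= S ->
    `|\sum_(j < N) z j * f (z j) - \sum_(j < N) z j * Bf (z j)| <=
      L * S / (2 * q).
  move=> z01 zS; rewrite -sumrB; apply: le_trans (ler_norm_sum _ _ _) _.
  apply: (@le_trans _ _ (\sum_(j < N) z j * (L / (2 * q)))).
    apply: ler_sum => j _; have /andP[z0 _] := z01 j.
    rewrite -mulrBr normrM (ger0_norm z0); apply: ler_wpM2l => //.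
    exact: bern_approx.
  rewrite -mulr_suml mulrC mulrAC; apply: ler_wpM2r.
    by rewrite invr_ge0 mulr_ge0 // ltW.
  exact: ler_wpM2l.
have swap (z : nat -> R) : \sum_(j < N) z j * Bf (z j) =
    \sum_(k < n.+1) f (k%:R / n%:R) * moment_sum n k N z.
  under eq_bigr do rewrite mulr_sumr.
  rewrite exchange_big; apply: eq_bigr => k _.
  by rewrite mulr_sumr; apply: eq_bigr => j _; ring.
have pair : \sum_(j < N) x j * Bf (x j) - \sum_(j < N) y j * Bf (y j) <=
    F * moment_dist n N x y.
  rewrite !swap -sumrB mulr_sumr; apply: ler_sum => k _.
  rewrite -mulrBr; apply: le_trans (ler_norm _) _; rewrite normrM.
  exact: ler_wpM2r.
have := approx x x01 xS; have := approx y y01 yS; rewrite !ler_norml.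
have -> : L * S / Num.sqrt n%:R = L * S / (2 * q) + L * S / (2 * q).
  by rewrite -/q; field; rewrite gt_eqF.
by move=> /andP[? ?] /andP[? ?]; lra.
Qed.

Lemma lipschitz_inv_max (R : realType) (c u v : R) : 0 < c ->
  `|(Num.max u c)^-1 - (Num.max v c)^-1| <= c ^- 2 * `|u - v|.
Proof.
move=> c0; set a := Num.max u c; set b := Num.max v c.
have ca : c <= a by rewrite le_max lexx orbT.
have cb : c <= b by rewrite le_max lexx orbT.
have a0 := lt_le_trans c0 ca; have b0 := lt_le_trans c0 cb.
have ab : `|b - a| <= `|u - v|.
  rewrite /a /b; case: (leP u c) => uc; case: (leP v c) => vc;
    rewrite ?subrr ?normr0 //.
  - by rewrite [leRHS]distrC !ger0_norm; lra.
  - by rewrite [leLHS]distrC !ger0_norm; lra.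
  - by rewrite distrC.
have -> : a^-1 - b^-1 = (a * b)^-1 * (b - a).
  by field; rewrite !gt_eqF.
rewrite normrM gtr0_norm ?invr_gt0 ?mulr_gt0 //.
apply: ler_pM => //; first by rewrite invr_ge0 mulr_ge0 // ltW.
rewrite lef_pV2 ?posrE ?mulr_gt0 ?exprn_gt0 // expr2.
by apply: ler_pM => //; exact: ltW.
Qed.

Lemma ler_dist_min (R : realType) (K a b c d : R) :
  `|a - c| <= K -> `|b - d| <= K -> `|Num.min a b - Num.min c d| <= K.
Proof.
rewrite !ler_norml => /andP[? ?] /andP[? ?].
by case: (leP a b) => ?; case: (leP c d) => ?; apply/andP; split; lra.
Qed.

(** A test function counts the terms above the gap. With c the middle of [y_m,
    x_m], the function [f] agrees with 1/t for t >= x_m, vanishes for t <= c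
    and is dominated by 1/t, so that t f(t) separates the first m.+1 terms of
    x from the terms of y of index at least m. The ramp starts at c rather
    than at y_m because its slope is of order 1/(d c) and c >= d/2, whereas
    y_m may vanish. *)
Lemma moment_gap_lt (R : realType) (n N m : nat) (S : R) (x y : nat -> R) :
  (0 < n)%N -> (m < N)%N ->
  nonincreasing_seq x -> nonincreasing_seq y ->
  (forall j, 0 <= x j <= 1) -> (forall j, 0 <= y j <= 1) ->
  \sum_(j < N) x j <= S -> \sum_(j < N) y j <= S -> y m < x m ->
  (x m - y m) ^+ 2 <= moment_dist n N x y + 4 * S / Num.sqrt n%:R.
Proof.
move=> n0 mN xd yd x01 y01 xS yS yx; set d := x m - y m.
have d0 : 0 < d by rewrite subr_gt0.
have /andP[xm0 xm1] := x01 m; have /andP[ym0 ym1] := y01 m.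
have d1 : d <= 1 by rewrite /d; lra.
have dx : d <= x m by rewrite /d; lra.
have x0 : 0 < x m := lt_le_trans d0 dx.
pose c := y m + d / 2; have c0 : 0 < c by rewrite /c; lra.
have dc : d / 2 <= c by rewrite /c; lra.
pose A (u : R) : R := 2 / d * (1 - c * (Num.max u c)^-1).
pose B (u : R) : R := (Num.max u (x m))^-1.
pose f (u : R) : R := Num.min (A u) (B u).
pose L := 4 / d ^+ 2.
have L0 : 0 <= L by rewrite divr_ge0 // exprn_ge0 // ltW.
have AL u v : `|A u - A v| <= L * `|u - v|.
  have -> : A u - A v = - (2 / d * c * ((Num.max u c)^-1 - (Num.max v c)^-1)).
    by rewrite /A; ring.
  have k0 : 0 <= 2 / d * c by rewrite !mulr_ge0 ?invr_ge0 // ltW.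
  rewrite normrN normrM (ger0_norm k0).
  apply: le_trans (ler_wpM2l k0 (lipschitz_inv_max u v c0)) _.
  rewrite mulrA; apply: ler_wpM2r => //.
  have -> : 2 / d * c * c ^- 2 = 2 / d * c^-1.
    by field; rewrite !gt_eqF.
  have -> : L = 2 / d * (d / 2)^-1 by rewrite /L; field; rewrite gt_eqF.
  apply: ler_wpM2l; first by rewrite divr_ge0 // ltW.
  by rewrite lef_pV2 ?posrE // divr_gt0.
have BL u v : `|B u - B v| <= L * `|u - v|.
  apply: le_trans (lipschitz_inv_max u v x0) _; apply: ler_wpM2r => //.
  apply: (@le_trans _ _ (d ^- 2)).
    by rewrite lef_pV2 ?posrE ?exprn_gt0 // lerXn2r // nnegrE ltW.
  by rewrite /L ler_peMl // ?invr_ge0 ?exprn_ge0 ?(ltW d0) // ler1n.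
have fL u v : `|f u - f v| <= L * `|u - v| by exact: ler_dist_min.
have max0 u (e : R) : 0 < e -> 0 < Num.max u e by rewrite lt_max orbC => ->.
have B0 u : 0 <= B u by rewrite invr_ge0 ltW // max0.
have f0 u : 0 <= f u.
  rewrite /f le_min B0 andbT mulr_ge0 ?divr_ge0 // ?(ltW d0) // subr_ge0.
  by rewrite ler_pdivrMr ?max0 // mul1r le_max lexx orbT.
have fF u : `|f u| <= d^-1.
  rewrite ger0_norm //; apply: (@le_trans _ _ (B u)).
    by rewrite /f ge_min lexx orbT.
  rewrite lef_pV2 ?posrE ?max0 //; apply: le_trans dx _.
  by rewrite le_max lexx orbT.
have f_le u : 0 <= u -> u * f u <= 1.
  move=> u0; apply: (@le_trans _ _ (u * B u)).
    by apply: ler_wpM2l => //; rewrite /f ge_min lexx orbT.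
  by rewrite ler_pdivrMr ?max0 // mul1r le_max lexx.
have f_ge u : x m <= u -> 1 <= u * f u.
  move=> xu; have u0 := lt_le_trans x0 xu.
  have cu : c <= u by move: xu; rewrite /c /d; lra.
  rewrite mulrC -ler_pdivrMr // mul1r /f le_min /A /B.
  rewrite (max_l xu) (max_l cu) lexx andbT -(ler_pM2r u0) mulVf ?gt_eqF //.
  have -> : 2 / d * (1 - c * u^-1) * u = (2 / d) * (u - c).
    by field; rewrite !gt_eqF.
  apply: (@le_trans _ _ (2 / d * (d / 2))).
    by rewrite le_eqVlt; apply/orP; left; apply/eqP; field; rewrite gt_eqF.
  apply: ler_wpM2l; first by rewrite divr_ge0 // ltW.
  by move: xu; rewrite /c /d; lra.
have f_eq0 u : u <= y m -> f u = 0.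
  move=> uy; have uc : u <= c by rewrite /c; lra.
  have A0 : A u = 0 by rewrite /A (max_r uc) divff ?gt_eqF // subrr mulr0.
  by rewrite /f A0 min_l.
have gap : 1 <= \sum_(j < N) x j * f (x j) - \sum_(j < N) y j * f (y j).
  have -> : 1 = \sum_(j < N) ((j : nat) == m)%:R :> R.
    rewrite (bigD1 (Ordinal mN)) //= eqxx big1 ?addr0 // => j.
    by rewrite -val_eqE /= => /negbTE ->.
  rewrite -sumrB; apply: ler_sum => j _.
  have /andP[xj0 _] := x01 j; have /andP[yj0 _] := y01 j.
  have [jm|jm|/= ->] := ltngtP j m.
  - have := f_ge _ (xd _ _ (ltnW jm)); have := f_le _ yj0; rewrite mulr0n; lra.
  - rewrite (f_eq0 _ (yd _ _ (ltnW jm))) mulr0 subr0.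
    by rewrite mulr_ge0.
  - by rewrite (f_eq0 _ (lexx _)) mulr0 subr0; exact: f_ge.
have := le_trans gap (moment_pairing n0 L0 x01 y01 xS yS fL fF).
move=> /(ler_wpM2l (exprn_ge0 2 (ltW d0))); rewrite mulr1 => /le_trans; apply.
have -> : d ^+ 2 * (d^-1 * moment_dist n N x y + L * S / Num.sqrt n%:R) =
    d * moment_dist n N x y + 4 * S / Num.sqrt n%:R.
  rewrite /L; field; rewrite !gt_eqF // sqrtr_gt0 ltr0n //.
rewrite lerD2r; apply: ler_piMl => //; exact: moment_dist_ge0.
Qed.

Lemma moment_gap (R : realType) (n N m : nat) (S : R) (x y : nat -> R) :
  (0 < n)%N -> (m < N)%N ->
  nonincreasing_seq x -> nonincreasing_seq y ->
  (forall j, 0 <= x j <= 1) -> (forall j, 0 <= y j <= 1) ->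
  \sum_(j < N) x j <= S -> \sum_(j < N) y j <= S ->
  (x m - y m) ^+ 2 <= moment_dist n N x y + 4 * S / Num.sqrt n%:R.
Proof.
move=> n0 mN xd yd x01 y01 xS yS.
have [xy|yx|->] := ltgtP (x m) (y m).
- have -> : (x m - y m) ^+ 2 = (y m - x m) ^+ 2 by ring.
  by rewrite moment_dist_sym; exact: moment_gap_lt.
- exact: moment_gap_lt.
- rewrite subrr expr0n addr_ge0 ?moment_dist_ge0 // divr_ge0 ?sqrtr_ge0 //.
  rewrite mulr_ge0 //; apply: le_trans yS; apply: sumr_ge0 => j _.
  by have /andP[] := y01 j.
Qed.

(** * Truncated moments and symmetric functions *)

(** Since min(eta, j^(-1/rho))^p = max(j, eta^(-rho))^(-p/rho), this is
    [sum_powR_max] with s = p/rho. It serves three times: p = 2 and eta = 1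
    bounds the mass by S_rho, p = 2 gives the l^2 distance, and general p the
    l^p distance. *)
Lemma sum_powR_le (R : realType) (rho p eta : R) (N : nat) (c : nat -> R) :
  0 < rho -> rho < p -> 0 <= eta -> (forall j, 0 <= c j) ->
  (forall j, c j <= j.+1%:R `^ (- rho^-1)) -> (forall j, c j <= eta) ->
  \sum_(j < N) c j `^ p <= p / (p - rho) * eta `^ (p - rho).
Proof.
move=> rho0 rhop eta0 c0 cdec ceta.
have p0 : 0 < p := lt_trans rho0 rhop.
have pr0 : 0 < p - rho by rewrite subr_gt0.
have [eta_eq|eta_neq] := eqVneq eta 0.
  rewrite eta_eq powR0 ?mulr0 ?gt_eqF // big1 // => j _.
  have -> : c j = 0 by apply/eqP; rewrite eq_le c0 -eta_eq ceta.
  by rewrite powR0 // gt_eqF.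
have {}eta0 : 0 < eta by rewrite lt_neqAle eq_sym eta_neq.
pose M := eta `^ (- rho); have M0 : 0 < M by rewrite powR_gt0.
have s1 : 1 < p / rho by rewrite ltr_pdivlMr // mul1r.
have -> : p / (p - rho) * eta `^ (p - rho) =
    p / rho / (p / rho - 1) * M `^ (1 - p / rho).
  rewrite /M -powRrM; congr (_ * _ `^ _); field; rewrite ?gt_eqF //; lra.
apply: (le_trans _ (sum_powR_max N s1 M0)); apply: ler_sum => j _.
have mx : c j <= Num.max j.+1%:R M `^ (- rho^-1).
  have [_|_] := leP j.+1%:R M; last exact: cdec.
  by rewrite /M -powRrM mulrNN divff ?gt_eqF // powRr1 // ltW.
have -> : - (p / rho) = - rho^-1 * p by rewrite mulNr mulrC.
by rewrite powRrM ge0_ler_powR ?nnegrE ?powR_ge0 // ltW.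
Qed.

(** Split s b(s) - t b(t) as (s - t) b(s) + t (b(s) - b(t)): the first parts
    add up to |s - t| over k and the second to at most 2n |s - t|. *)
Lemma moment_dist_le (R : realType) (n N : nat) (x y : nat -> R) :
  (forall j, 0 <= x j <= 1) -> (forall j, 0 <= y j <= 1) ->
  moment_dist n N x y <= (2 * n%:R + 1) * \sum_(j < N) `|x j - y j|.
Proof.
move=> x01 y01; rewrite /moment_dist /moment_sum.
apply: (@le_trans _ _ (\sum_(k < n.+1) \sum_(j < N)
    (`|x j - y j| * bern n k (x j) + `|bern n k (x j) - bern n k (y j)|))).
  apply: ler_sum => k _; rewrite -sumrB; apply: le_trans (ler_norm_sum _ _ _) _.
  apply: ler_sum => j _; have /andP[y0 y1] := y01 j.
  have -> : x j * bern n k (x j) - y j * bern n k (y j) =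
      (x j - y j) * bern n k (x j) + y j * (bern n k (x j) - bern n k (y j)).
    by ring.
  apply: le_trans (ler_normD _ _) _.
  rewrite (normrM (x j - y j)) (normrM (y j)).
  rewrite (ger0_norm (bern_ge0 _ _ (x01 j))) lerD2l (ger0_norm y0).
  exact: ler_piMl.
rewrite exchange_big mulr_sumr; apply: ler_sum => j _.
rewrite big_split /= -mulr_sumr bern_sum1 mulr1 mulrDl mul1r addrC lerD2r.
exact: bern_variation.
Qed.

Section ElementarySymmetric.
Context {R : realType}.
Implicit Types (x y : nat -> R) (N k : nat).

(** Elementary symmetric function of degree k of x_0, ..., x_(N-1), by
    splitting the monomials according to whether they contain x_(N-1). *)
Fixpoint esym N k x : R :=
  match N, k with
  | _, 0 => 1
  | 0, _.+1 => 0
  | N'.+1, k'.+1 => esym N' k'.+1 x + x N' * esym N' k' x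
  end.

Lemma esym0 N x : esym N 0 x = 1. Proof. by case: N. Qed.

(** Monomials sorted by their largest index. This form, with j ranging over
    the largest index, drives the estimates below. *)
Lemma esymS N k x : esym N k.+1 x = \sum_(j < N) x j * esym j k x.
Proof. by elim: N => [|N IH]; rewrite ?big_ord0 // big_ord_recr /= -IH. Qed.

Lemma esym_ge0 N k x : (forall j, 0 <= x j) -> 0 <= esym N k x.
Proof.
move=> x0; elim: k N => [|k IH] N; first by rewrite esym0.
by rewrite esymS sumr_ge0 // => j _; rewrite mulr_ge0.
Qed.

Lemma esym_nondecreasing k x : (forall j, 0 <= x j) ->
  nondecreasing_seq (fun N => esym N k x).
Proof.
move=> x0; apply/nondecreasing_seqP => N.
case: k => [|k]; first by rewrite !esym0.
by rewrite /= lerDl mulr_ge0 // esym_ge0.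
Qed.

Lemma esym_le N k x (S : R) : (forall j, 0 <= x j) -> 
  (forall M, \sum_(j < M) x j <= S) -> esym N k x <= S ^+ k.
Proof.
move=> x0 xS; have S0 : 0 <= S by have := xS 0; rewrite big_ord0.
elim: k N => [|k IH] N; first by rewrite esym0 expr0.
rewrite esymS exprS; apply: (@le_trans _ _ (\sum_(j < N) x j * S ^+ k)).
  by apply: ler_sum => j _; exact: ler_wpM2l.
by rewrite -mulr_suml ler_wpM2r // exprn_ge0.
Qed.

(** Induction on k through [esymS]: change the factor of largest index first,
    then the remaining factor of degree k. *)
Lemma esym_lipschitz N k x y (S D : R) :
  (forall j, 0 <= x j) -> (forall j, 0 <= y j) ->
  (forall M, \sum_(j < M) x j <= S) -> (forall M, \sum_(j < M) y j <= S) ->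
  (forall M, \sum_(j < M) `|x j - y j| <= D) ->
  `|esym N k x - esym N k y| <= k%:R * S ^+ k.-1 * D.
Proof.
move=> x0 y0 xS yS xyD; have S0 : 0 <= S by have := xS 0; rewrite big_ord0.
have D0 : 0 <= D by have := xyD 0; rewrite big_ord0.
elim: k N => [|k IH] N; first by rewrite !esym0 subrr normr0 !mul0r.
rewrite !esymS -sumrB; apply: le_trans (ler_norm_sum _ _ _) _.
set B := k%:R * _ * D in IH.
apply: (@le_trans _ _ (\sum_(j < N) (`|x j - y j| * S ^+ k + y j * B))).
  apply: ler_sum => j _.
  have -> : x j * esym j k x - y j * esym j k y =
      (x j - y j) * esym j k x + y j * (esym j k x - esym j k y) by ring.
  apply: le_trans (ler_normD _ _) _; rewrite !normrM (ger0_norm (y0 j)).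
  apply: lerD; apply: ler_wpM2l => //.
  by rewrite ger0_norm ?esym_ge0 // esym_le.
rewrite big_split /= -!mulr_suml.
apply: (@le_trans _ _ (D * S ^+ k + S * B)).
  have B0 : 0 <= B by rewrite /B !mulr_ge0 ?exprn_ge0.
  by apply: lerD; apply: ler_wpM2r; rewrite ?exprn_ge0 //;
    [exact: xyD | exact: yS].
rewrite le_eqVlt; apply/orP; left; apply/eqP.
rewrite /B -natr1 /=; case: k {IH B} => [|k] /=; first by rewrite !mul0r; ring.
by rewrite exprS; ring.
Qed.

(** Index m holds the power sum of degree m.+1. *)
Definition psum N m x : R := \sum_(j < N) x j ^+ m.+1.

(** Induction on the number of variables: adding a variable c turns e_(k+1)
    into e_(k+1) + c e_k and p_i into p_i + c^(i+1), and the terms of highest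
    degree in c telescope ([AS]). *)
Lemma newton_identity N k x :
  k.+1%:R * esym N k.+1 x =
  \sum_(i < k.+1) (-1) ^+ i * esym N (k - i) x * psum N i x.
Proof.
elim: N k => [|N IH] k.
  by rewrite /= mulr0 big1 // => i _; rewrite /psum big_ord0 mulr0.
pose c := x N.
have psumS i : psum N.+1 i x = psum N i x + c ^+ i.+1.
  by rewrite /psum big_ord_recr.
pose A j := \sum_(i < j.+1) (-1) ^+ i * esym N (j - i) x * c ^+ i.+1.
have AS j : A j.+1 = c * esym N j.+1 x - c * A j.
  rewrite /A big_ord_recl subn0 expr0 expr1; congr (_ + _); first by ring.
  rewrite mulr_sumr -sumrN; apply: eq_bigr => i _.
  by rewrite /bump /= ?add1n subSS !exprS; ring.
case: k => [|k].
  have := IH 0; rewrite !big_ord1 /= !subnn !esym0 psumS /c !mul1r => ->.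
  by rewrite mulr1 expr1.
rewrite big_ord_recr subnn esym0 psumS /=.
under eq_bigr => i _.
  rewrite subSn ?leq_ord //= psumS -/c.
  rewrite (_ : _ * _ * _ =
    ((-1) ^+ i * esym N (k.+1 - i) x * psum N i x +
     (-1) ^+ i * esym N (k.+1 - i) x * c ^+ i.+1) +
    (c * ((-1) ^+ i * esym N (k - i) x * psum N i x) +
     c * ((-1) ^+ i * esym N (k - i) x * c ^+ i.+1))); last first.
    by rewrite subSn ?leq_ord //; ring.
  over.
rewrite !big_split /= -!mulr_sumr -/(A k) -IH.
have := AS k; rewrite {1}/A big_ord_recr /= subnn esym0 => AE.
have := IH k.+1; rewrite big_ord_recr /= subnn esym0 => IE.
rewrite -/c -!natr1; rewrite -!natr1 in IE.
set s1 := \sum_(i < k.+1) _ in IE *; set s2 := \sum_(i < k.+1) _ in AE *.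
have -> : s1 =
    (k%:R + 1 + 1) * esym N k.+2 x - (-1) ^+ k.+1 * 1 * psum N k.+1 x.
  by rewrite IE addrK.
have -> : s2 = c * esym N k.+1 x - c * A k - (-1) ^+ k.+1 * 1 * c ^+ k.+2.
  by rewrite -AE addrK.
ring.
Qed.

End ElementarySymmetric.

(** * Moments as Lipschitz functions of the elementary symmetric functions *)

Definition esym_dist (R : realType) (m N : nat) (x y : nat -> R) : R :=
  \sum_(k < m) `|esym N k.+1 x - esym N k.+1 y|.

Lemma esym_dist_ge0 (R : realType) m N (x y : nat -> R) :
  0 <= esym_dist m N x y.
Proof. exact: sumr_ge0. Qed.

Lemma esym_distS (R : realType) m N (x y : nat -> R) :
  esym_dist m.+1 N x y =
  esym_dist m N x y + `|esym N m.+1 x - esym N m.+1 y|.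
Proof. by rewrite /esym_dist big_ord_recr. Qed.

Lemma esym_dist_mono (R : realType) m m' N (x y : nat -> R) : (m <= m')%N ->
  esym_dist m N x y <= esym_dist m' N x y.
Proof.
move=> /subnKC <-; elim: (m' - m)%N => [|d IH]; first by rewrite addn0.
by rewrite addnS esym_distS (le_trans IH) // lerDl.
Qed.

Lemma esym_dist_term (R : realType) m N k (x y : nat -> R) : (k <= m)%N ->
  `|esym N k x - esym N k y| <= esym_dist m N x y.
Proof.
case: k => [|k] km; first by rewrite !esym0 subrr normr0 esym_dist_ge0.
apply: le_trans (esym_dist_mono _ _ _ km).
by rewrite esym_distS lerDr esym_dist_ge0.
Qed.

Section MomentsFromElementary.
Context {R : realType}.
Variable S : R.
Hypothesis S1 : 1 <= S.

(** What the estimates use of the normalized squares x_j of a spectrum. *)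
Definition unit_seq (x : nat -> R) : Prop :=
  (forall j, 0 <= x j <= 1) /\ (forall M, \sum_(j < M) x j <= S).

Lemma psum_bounds N m x : unit_seq x -> 0 <= psum N m x <= S.
Proof.
move=> [x01 xS]; apply/andP; split.
  by apply: sumr_ge0 => j _; rewrite exprn_ge0 //; have /andP[] := x01 j.
apply: le_trans (xS N); apply: ler_sum => j _; have /andP[x0 x1] := x01 j.
by rewrite exprS ler_piMr // exprn_ile1.
Qed.

Lemma esym_bounds N k m x : unit_seq x -> (k <= m)%N ->
  0 <= esym N k x <= S ^+ m.
Proof.
move=> [x01 xS] km.
have x0 j : 0 <= x j by have /andP[] := x01 j.
rewrite esym_ge0 //=; apply: le_trans (esym_le N k x0 xS) _.
exact: ler_weXn2l.
Qed.

(** Newton's identity expresses the power sum of index m through e_1, ...,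
    e_(m+1) and the previous power sums. All the quantities multiplied are
    bounded in terms of S and m only, so the Lipschitz constant depends
    neither on the sequences nor on the truncation rank. *)
Lemma psum_lipschitz m : exists2 L : R, 0 <= L &
  forall i N x y, (i < m)%N -> unit_seq x -> unit_seq y ->
  `|psum N i x - psum N i y| <= L * esym_dist m N x y.
Proof.
elim: m => [|m [L L0 IH]]; first by exists 0.
have S0 : 0 <= S := le_trans ler01 S1.
exists (m.+1%:R + m%:R * (S + S ^+ m * L) + L).
  by rewrite !addr_ge0 // mulr_ge0 // addr_ge0 // mulr_ge0 // exprn_ge0.
move=> i N x y; rewrite ltnS leq_eqVlt => /predU1P[->|im] xU yU; last first.
  apply: le_trans (IH i N x y im xU yU) _; apply: ler_pM => //.
  - exact: esym_dist_ge0.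
  - by rewrite lerDr addr_ge0 // mulr_ge0 // addr_ge0 // mulr_ge0 // exprn_ge0.
  - exact: esym_dist_mono.
set D := esym_dist m.+1 N x y; have D0 : 0 <= D := esym_dist_ge0 _ _ _ _.
have psumE z : psum N m z = (-1) ^+ m * (m.+1%:R * esym N m.+1 z -
    \sum_(i < m) (-1) ^+ i * esym N (m - i) z * psum N i z).
  rewrite newton_identity big_ord_recr /= subnn esym0 mulr1 addrAC subrr add0r.
  by rewrite mulrA -exprD addnn -mul2n exprM sqrrN !expr1n mul1r.
rewrite !psumE -mulrBr normrM normrX normrN1 expr1n mul1r.
have -> : forall a b c d e : R, a * b - c - (a * d - e) = a * (b - d) - (c - e).
  by move=> *; ring.
apply: le_trans (ler_normB _ _) _; rewrite 2!mulrDl -[leLHS]addr0.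
apply: lerD; last by rewrite mulr_ge0.
apply: lerD.
  by rewrite normrM ger0_norm //; apply: ler_wpM2l => //; exact: esym_dist_term.
rewrite -sumrB; apply: le_trans (ler_norm_sum _ _ _) _.
have -> : m%:R * (S + S ^+ m * L) * D = \sum_(i < m) (S + S ^+ m * L) * D.
  by rewrite sumr_const card_ord -[RHS]mulr_natl mulrA.
apply: ler_sum => j _; rewrite -!mulrA -mulrBr.
rewrite normrM normrX normrN1 expr1n mul1r.
have -> : forall a b c d : R, a * b - c * d = (a - c) * b + c * (b - d).
  by move=> *; ring.
apply: le_trans (ler_normD _ _) _; rewrite !normrM mulrDl.
have /andP[p0 pS] := psum_bounds N j xU.
have /andP[e0 eS] := esym_bounds N yU (leq_subr j m).
apply: lerD.
  rewrite mulrC (ger0_norm p0); apply: ler_pM => //.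
  by apply: esym_dist_term; rewrite leqW // leq_subr.
rewrite (ger0_norm e0) -mulrA; apply: ler_pM => //.
apply: le_trans (IH j N x y (ltn_ord j) xU yU) _.
by apply: ler_wpM2l => //; exact: esym_dist_mono.
Qed.

(** The factors 1 - t are removed one at a time, by t^(k+1) (1-t)^(l+1) =
    t^(k+1) (1-t)^l - t^(k+2) (1-t)^l. *)
Lemma mixed_moment_lipschitz m (L : R) (N : nat) (x y : nat -> R) : 0 <= L ->
  (forall i, (i < m)%N ->
    `|psum N i x - psum N i y| <= L * esym_dist m N x y) ->
  forall l k, (k + l < m)%N ->
  `|\sum_(j < N) x j ^+ k.+1 * (1 - x j) ^+ l -
    \sum_(j < N) y j ^+ k.+1 * (1 - y j) ^+ l| <=
    2 ^+ l * (L * esym_dist m N x y).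
Proof.
move=> L0 H; elim=> [|l IH] k klm.
  rewrite addn0 in klm; rewrite expr0 mul1r.
  by under eq_bigr do rewrite expr0 mulr1; under [X in _ - X]eq_bigr do
    rewrite expr0 mulr1; exact: H.
have step (z : nat -> R) : \sum_(j < N) z j ^+ k.+1 * (1 - z j) ^+ l.+1 =
    \sum_(j < N) z j ^+ k.+1 * (1 - z j) ^+ l -
    \sum_(j < N) z j ^+ k.+2 * (1 - z j) ^+ l.
  by rewrite -sumrB; apply: eq_bigr => j _; rewrite !exprS; ring.
have h1 : (k + l < m)%N by apply: leq_trans klm; rewrite addnS ltnS.
have h2 : (k.+1 + l < m)%N by rewrite addSnnS.
have := IH k h1; have := IH k.+1 h2; rewrite !step !exprS !ler_norml.
by move=> /andP[? ?] /andP[? ?]; apply/andP; split; lra.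
Qed.

Lemma moment_dist_esym n : exists2 L : R, 0 <= L &
  forall N x y, unit_seq x -> unit_seq y ->
  moment_dist n N x y <= L * esym_dist n.+1 N x y.
Proof.
have [L L0 HL] := psum_lipschitz n.+1.
exists (\sum_(k < n.+1) 'C(n, k)%:R * 2 ^+ (n - k) * L).
  by apply: sumr_ge0 => k _; rewrite !mulr_ge0.
move=> N x y xU yU; rewrite mulr_suml; apply: ler_sum => k _.
have E (z : nat -> R) : moment_sum n k N z =
    'C(n, k)%:R * \sum_(j < N) z j ^+ k.+1 * (1 - z j) ^+ (n - k).
  by rewrite mulr_sumr; apply: eq_bigr => j _; rewrite /bern exprS; ring.
rewrite !E -mulrBr normrM ger0_norm // -!mulrA; apply: ler_wpM2l => //.
apply: mixed_moment_lipschitz => //; last by rewrite subnKC // -ltnS.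
by move=> i im; exact: HL.
Qed.

End MomentsFromElementary.

(** * Infinite elementary symmetric functions as limits *)

(** A list, without repetition, of the subsets of size k of {0, ..., N-1},
    built by the recursion that defines [esym]. *)
Fixpoint ksubsets (N k : nat) : seq {fset nat} :=
  match N, k with
  | _, 0 => [:: fset0]
  | 0, _.+1 => [::]
  | N'.+1, k'.+1 =>
      ksubsets N' k'.+1 ++ [seq (N' |` A)%fset | A <- ksubsets N' k']
  end.

Lemma ksubsetsP N k (A : {fset nat}) :
  A \in ksubsets N k <-> #|` A|%fset = k /\ forall i, i \in A -> (i < N)%N.
Proof.
elim: N k A => [|N IH] [|k] A /=.
- rewrite inE; split=> [/eqP->|[/eqP]]; first by split=> // i.
  by rewrite cardfs_eq0.
- split=> // -[Ak A0]; have /fset0Pn[i /A0] // : A != fset0.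
  by rewrite -cardfs_eq0 Ak.
- rewrite inE; split=> [/eqP->|[/eqP]]; first by split=> // i.
  by rewrite cardfs_eq0.
rewrite mem_cat; split=> [/orP[/IH[Ak AN]|/mapP[B /IH[Bk BN] ->]]|[Ak AN]].
- by split=> // i /AN /ltnW.
- have NB : N \notin B by apply/negP => /BN; rewrite ltnn.
  split; first by rewrite cardfsU1 NB Bk.
  by move=> i; rewrite in_fset1U => /predU1P[->//|/BN/ltnW].
have [NA|NA] := boolP (N \in A); apply/orP; [right|left].
  apply/mapP; exists (A `\ N)%fset; last by rewrite fsetD1K.
  apply/IH; split.
    by move: Ak; rewrite (cardfsD1 N A) NA => -[].
  move=> i; rewrite in_fsetD1 => /andP[iN /AN].
  by rewrite ltnS leq_eqVlt (negbTE iN).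
apply/IH; split=> // i iA; have := AN i iA.
rewrite ltnS leq_eqVlt => /predU1P[iN|//].
by move: NA; rewrite -iN iA.
Qed.

Lemma ksubsets_notin N k A : A \in ksubsets N k -> N \notin A.
Proof. by move=> /ksubsetsP[_ AN]; apply/negP => /AN; rewrite ltnn. Qed.

Lemma ksubsets_uniq N k : uniq (ksubsets N k).
Proof.
elim: N k => [|N IH] [|k] //=; rewrite cat_uniq IH /=; apply/andP; split.
  apply/hasPn => _ /mapP[B _ ->]; apply/negP => /ksubsets_notin.
  by rewrite in_fset1U eqxx.
rewrite map_inj_in_uniq // => A B /ksubsets_notin NA /ksubsets_notin NB AB.
by rewrite -(fsetU1K NA) AB fsetU1K.
Qed.

Lemma esym_ksubsets (R : realType) N k (x : nat -> R) :
  esym N k x = \sum_(A <- ksubsets N k) \prod_(j <- A) x j.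
Proof.
elim: N k => [|N IH] [|k] /=.
- by rewrite big_seq1 big_seq_fset0.
- by rewrite big_nil.
- by rewrite big_seq1 big_seq_fset0.
rewrite big_cat big_map /= -IH (IH k) mulr_sumr; congr (_ + _).
rewrite big_seq [RHS]big_seq; apply: eq_bigr => A /ksubsets_notin NA.
by rewrite big_fsetU1.
Qed.

(** A finite family of finite sets of naturals is contained in the subsets of
    some {0, ..., N-1}. *)
Lemma esum_esym (R : realType) k (x : nat -> R) : (forall j, 0 <= x j) ->
  \esum_(A in [set A : {fset nat} | #|` A| = k]) (\prod_(j <- A) x j)%:E =
  ereal_sup (range (fun N => (esym N k x)%:E)).
Proof.
move=> x0.
have sumE N : (\sum_(A \in [set` ksubsets N k]) (\prod_(j <- A) x j)%:E =
    (esym N k x)%:E)%E.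
  by rewrite -fsbig_seq ?ksubsets_uniq // esym_ksubsets sumEFin.
apply/eqP; rewrite eq_le; apply/andP; split.
  apply: ge_ereal_sup => _ [X [finX XI] <-].
  pose N := (\max_(A <- fset_set X) \max_(i <- A) i.+1)%N.
  apply: (@le_trans _ _ (esym N k x)%:E); last first.
    by apply: ereal_sup_ubound; exists N.
  rewrite -sumE; apply: lee_fsum_nneg_subset => //.
  - exact: finite_seq.
  - apply/subsetP => A XA; apply/ksubsetsP.
    split=> [|i iA]; first exact: XI.
    have AX : A \in fset_set X by rewrite in_fset_set // inE.
    have AN : (\max_(i <- A) i.+1 <= N)%N.
      by rewrite /N; apply: leq_bigmax_seq.
    apply: leq_trans AN.
    by apply: leq_bigmax_seq.
  - by move=> A _; rewrite lee_fin prodr_ge0.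
apply: ge_ereal_sup => _ [N _ <-]; apply: esum_ge.
exists [set` ksubsets N k]; last by rewrite sumE.
by split; [exact: finite_seq | move=> A /ksubsetsP[]].
Qed.

Lemma esym_cvg (R : realType) k (x : nat -> R) (S : R) : (forall j, 0 <= x j) ->
  (forall M, \sum_(j < M) x j <= S) ->
  esym N k x @[N --> \oo] --> elem_sym k x.
Proof.
move=> x0 xS; rewrite /elem_sym esum_esym //.
have nd : nondecreasing_seq (fun N => (esym N k x)%:E).
  by move=> m n mn; rewrite lee_fin esym_nondecreasing.
have cv := ereal_nondecreasing_cvgn nd.
set l := ereal_sup _ in cv *.
have lfin : l \is a fin_num.
  rewrite fin_numElt; apply/andP; split.
    apply: (@lt_le_trans _ _ (esym 0 k x)%:E); first exact: ltNyr.
    by apply: ereal_sup_ubound; exists 0%N.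
  apply: (@le_lt_trans _ _ (S ^+ k)%:E); last exact: ltry.
  by apply: ge_ereal_sup => _ [N _ <-]; rewrite lee_fin esym_le.
apply: (@fine_cvg _ _ _ _ (fun N => (esym N k x)%:E)).
by rewrite fineK.
Qed.

(** * Normalized spectra and their moments *)

Section Spectra.
Context {R : realType}.
Variables rho C : R.
Hypotheses (rho0 : 0 < rho) (rho2 : rho < 2) (C0 : 0 < C).
Implicit Types a b : nat -> R.

Lemma S_ge1 : 1 <= S_ rho.
Proof. by rewrite /S_ ler_pdivlMr ?mul1r ?subr_gt0 // gerBl ltW. Qed.

Lemma normalized_ge0 a j : spectra rho C a -> 0 <= a j / C.
Proof. by move=> [_ a0 _]; rewrite divr_ge0 // ltW. Qed.

Lemma normalized_le a j : spectra rho C a -> a j / C <= j.+1%:R `^ (- rho^-1).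
Proof. by move=> [_ _ aC]; rewrite ler_pdivrMr // mulrC. Qed.

Lemma powR_decay_le1 j : (j.+1%:R : R) `^ (- rho^-1) <= 1.
Proof.
rewrite powRN invf_le1 ?powR_gt0 ?ltr0n //.
rewrite -[leLHS](powRr0 (j.+1%:R : R)) ler_powR ?ler1n //.
by rewrite invr_ge0 ltW.
Qed.

Lemma sqvar_unit a : spectra rho C a -> unit_seq (S_ rho) (sqvar C a).
Proof.
move=> aK; split=> [j|M].
  rewrite /sqvar sqr_ge0 /= expr_le1 ?normalized_ge0 //.
  exact: le_trans (normalized_le j aK) (powR_decay_le1 j).
have := @sum_powR_le R rho 2 1 M (fun j => a j / C) rho0 rho2 ler01.
rewrite powR1 mulr1 => H; apply: le_trans (H _ _ _) => [|j|j|j].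
- rewrite le_eqVlt; apply/orP; left; apply/eqP; apply: eq_bigr => j _.
  by rewrite /sqvar -powR_mulrn // normalized_ge0.
- exact: normalized_ge0.
- exact: normalized_le.
- exact: le_trans (normalized_le j aK) (powR_decay_le1 j).
Qed.

Lemma sqvar_nonincreasing a : spectra rho C a ->
  nonincreasing_seq (sqvar C a).
Proof.
move=> aK m n mn; have [ad _ _] := aK; rewrite /sqvar.
rewrite ler_pXn2r ?nnegrE ?normalized_ge0 //.
by rewrite ler_pM2r ?invr_gt0 // ad.
Qed.

(** The measure is a series of point masses, so a nonnegative function
    integrates to a series of values. *)
Lemma ge0_integral_spectral a (f : R -> \bar R) :
  @measurable_fun _ _ R (\bar R) setT f ->
  (forall t, (0 <= f t)%E) ->
  (\int[spectral_measure C a]_t f t =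
   \sum_(0 <= j <oo) (sqvar C a j)%:E * f (sqvar C a j))%E.
Proof.
move=> mf f0; rewrite ge0_integral_measure_series //.
apply: eq_eseriesr => j _.
rewrite ge0_integral_mscale // integral_dirac // diracT mul1e.
by [].
Qed.

(** The Bernstein polynomial may be negative off [0, 1]. Its positive and
    negative parts are integrated separately, and the negative one vanishes at
    all the atoms. *)
Lemma moment_sum_cvg a n k : spectra rho C a ->
  moment_sum n k N (sqvar C a) @[N --> \oo] --> bernstein_moment C n k a.
Proof.
move=> aK; have [x01 xS] := sqvar_unit aK.
set x := sqvar C a in x01 xS *.
pose f (t : R) : \bar R := (bern n k t)%:E.
have mf : @measurable_fun _ _ R (\bar R) setT f.
  apply/measurable_EFinP; apply: measurable_funM.
    by apply: measurable_funM => //; exact: measurable_funX.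
  by apply: measurable_funX; exact: measurable_funB.
have fx j : f^\+%E (x j) = (bern n k (x j))%:E.
  by rewrite funeposE /f max_l // lee_fin bern_ge0.
have fx' j : f^\-%E (x j) = 0%E.
  by rewrite funenegE /f max_r // lee_fin oppr_le0 bern_ge0.
have xb0 j : 0 <= x j * bern n k (x j).
  by rewrite mulr_ge0 ?bern_ge0 //; have /andP[] := x01 j.
have intE : (\int[spectral_measure C a]_t f t =
    \sum_(0 <= j <oo) (x j * bern n k (x j))%:E)%E.
  rewrite integralE ge0_integral_spectral //; last exact: measurable_funepos.
  rewrite ge0_integral_spectral //; last exact: measurable_funeneg.
  rewrite [X in (_ - X)%E]eseries0 => [|j _ _]; last by rewrite -/x fx' mule0.
  by rewrite sube0; apply: eq_eseriesr => j _; rewrite -/x fx EFinM.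
rewrite /bernstein_moment /Rintegral -/f intE.
have cv := @is_cvg_nneseries R (fun j => (x j * bern n k (x j))%:E) xpredT 0%N
  (fun j _ _ => ltac:(rewrite lee_fin; exact: xb0)).
set l := limn _ in cv *.
have sumE N : (\sum_(0 <= j < N) (x j * bern n k (x j))%:E =
   (moment_sum n k N x)%:E)%E.
  by rewrite /moment_sum sumEFin big_mkord.
have lfin : l \is a fin_num.
  rewrite ge0_fin_numE; last by apply: nneseries_ge0 => j _ _; rewrite lee_fin.
  apply: (@le_lt_trans _ _ (S_ rho)%:E); last exact: ltry.
  apply: lime_le => //; apply: nearW => N; rewrite sumE lee_fin.
  apply: le_trans (xS N); apply: ler_sum => j _.
  have /andP[xj0 _] := x01 j; apply: ler_piMr => //.
  have [kn|nk] := leqP k n; last by rewrite bern_small.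
  rewrite -(bern_sum1 n (x j)) (bigD1 (Ordinal (kn : (k < n.+1)%N))) //= lerDl.
  by apply: sumr_ge0 => i _; exact: bern_ge0.
apply: (@fine_cvg _ _ _ _ (fun N => (moment_sum n k N x)%:E)).
rewrite fineK //; under eq_fun do rewrite -sumE.
exact: cv.
Qed.

End Spectra.

(** * The two bounds on Bernstein moments *)

Section Estimates.
Context {R : realType}.
Variables rho C : R.
Hypotheses (rho0 : 0 < rho) (rho2 : rho < 2) (C0 : 0 < C).
Implicit Types a b : nat -> R.

Lemma spectra_dist_decay a b j : spectra rho C a -> spectra rho C b ->
  `|a j - b j| <= C * j.+1%:R `^ (- rho^-1).
Proof.
move=> [_ a0 aC] [_ b0 bC]; rewrite ler_norml.
by have := a0 j; have := b0 j; have := aC j; have := bC j; lra.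
Qed.

Lemma spectra_dist_le_C a b j : spectra rho C a -> spectra rho C b ->
  `|a j - b j| <= C.
Proof.
move=> aK bK; apply: le_trans (spectra_dist_decay j aK bK) _.
by rewrite ler_piMr ?(ltW C0) // powR_decay_le1.
Qed.

Lemma dist_le_sup a b j : spectra rho C a -> spectra rho C b ->
  `|a j - b j| <= sup_dist a b.
Proof.
move=> aK bK; apply: ub_le_sup; last by exists j.
by exists C => _ [i _ <-]; exact: spectra_dist_le_C.
Qed.

Lemma sup_dist_ge0 a b : spectra rho C a -> spectra rho C b ->
  0 <= sup_dist a b.
Proof. by move=> aK bK; apply: le_trans (dist_le_sup 0 aK bK). Qed.

Lemma dist_normalized a b j : `|a j / C - b j / C| = `|a j - b j| / C.
Proof. by rewrite -mulrBl normrM [X in _ * X]gtr0_norm // invr_gt0. Qed.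

(** |x_j - y_j| is the product of |a_j - b_j| / C and (a_j + b_j) / C; the
    squares of the factors sum to at most S_rho eta^(2-rho) and 4 S_rho. *)
Lemma sqvar_l1_dist a b (eta : R) N : spectra rho C a -> spectra rho C b ->
  0 <= eta -> (forall j, `|a j - b j| <= C * eta) ->
  \sum_(j < N) `|sqvar C a j - sqvar C b j| <=
    2 * S_ rho * eta `^ (1 - rho / 2).
Proof.
move=> aK bK eta0 abeta.
have abC j : `|a j / C - b j / C| <= eta.
  by rewrite dist_normalized ler_pdivrMr // mulrC.
have xyE j : `|sqvar C a j - sqvar C b j| =
    `|a j / C - b j / C| * (a j / C + b j / C).
  rewrite /sqvar subr_sqr normrM [X in _ * X]ger0_norm //.
  by apply: addr_ge0; [exact: (normalized_ge0 C0 j aK)|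
                       exact: (normalized_ge0 C0 j bK)].
have [eta_eq|eta_neq] := eqVneq eta 0.
  have S0 : 0 <= S_ rho := le_trans ler01 (S_ge1 rho0 rho2).
  rewrite big1 => [|j _].
    exact: mulr_ge0 (mulr_ge0 (ler0n _ 2) S0) (powR_ge0 _ _).
  have : `|a j / C - b j / C| <= 0 by rewrite -eta_eq.
  by rewrite xyE normr_le0 => /eqP->; rewrite normr0 mul0r.
have {}eta0 : 0 < eta by rewrite lt_neqAle eq_sym eta_neq.
set h := eta `^ (1 - rho / 2); have h0 : 0 < h by rewrite powR_gt0.
have h2 : eta `^ (2 - rho) = h ^+ 2.
  rewrite -powR_mulrn ?powR_ge0 // /h -powRrM; congr (_ `^ _); by field.
have l2 : \sum_(j < N) `|a j / C - b j / C| ^+ 2 <= S_ rho * h ^+ 2.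
  have := @sum_powR_le R rho 2 eta N (fun j => `|a j / C - b j / C|)
    rho0 rho2 (ltW eta0).
  rewrite h2 => H; apply: le_trans (H _ _ _) => [|j|j|j] //.
    rewrite le_eqVlt; apply/orP; left; apply/eqP; apply: eq_bigr => j _.
    by rewrite -powR_mulrn.
  by rewrite dist_normalized ler_pdivrMr // mulrC; exact: spectra_dist_decay.
have [_ aS] := sqvar_unit rho0 rho2 C0 aK.
have [_ bS] := sqvar_unit rho0 rho2 C0 bK.
(* Cauchy-Schwarz in its additive form, with the weight h *)
apply: (@le_trans _ _ (\sum_(j < N) (h^-1 * `|a j / C - b j / C| ^+ 2 +
    h / 2 * (sqvar C a j + sqvar C b j)))).
  apply: ler_sum => j _; rewrite xyE /sqvar.
  set u := a j / C; set v := b j / C; set w := `|u - v|.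
  rewrite -(ler_pM2l h0).
  have -> : h * (h^-1 * w ^+ 2 + h / 2 * (u ^+ 2 + v ^+ 2)) =
      w ^+ 2 + h ^+ 2 / 2 * (u ^+ 2 + v ^+ 2) by field; rewrite gt_eqF.
  (* the second square replaces (u + v)^2 by 2 (u^2 + v^2) *)
  have := sqr_ge0 (w - h * (u + v) / 2); have := sqr_ge0 (h * (u - v)).
  by lra.
rewrite big_split /= -!mulr_sumr big_split /=.
have := ler_wpM2l (_ : 0 <= h^-1) l2; rewrite invr_ge0 ltW // => /(_ isT).
have -> : h^-1 * (S_ rho * h ^+ 2) = S_ rho * h.
  by field; rewrite gt_eqF.
have hh : 0 <= h / 2 by rewrite divr_ge0 // ltW.
have := ler_wpM2l hh (lerD (aS N) (bS N)); lra.
Qed.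

Lemma moment_dist_cvg n a b : spectra rho C a -> spectra rho C b ->
  moment_dist n N (sqvar C a) (sqvar C b) @[N --> \oo] --> qn C n a b.
Proof.
move=> aK bK; rewrite /moment_dist /qn.
apply: cvg_big => [|k _]; first exact: add_continuous.
by apply: cvg_norm; apply: cvgB; exact: (moment_sum_cvg rho0 rho2 C0).
Qed.

Lemma qn_le n a b : spectra rho C a -> spectra rho C b ->
  qn C n a b <= 2 * (2 * n%:R + 1) * S_ rho *
    (sup_dist a b / C) `^ (1 - rho / 2).
Proof.
move=> aK bK; apply: (cvgr_to_le (moment_dist_cvg aK bK)).
apply: nearW => N.
have [x01 _] := sqvar_unit rho0 rho2 C0 aK.
have [y01 _] := sqvar_unit rho0 rho2 C0 bK.
apply: le_trans (moment_dist_le _ _ x01 y01) _.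
have eta0 : 0 <= sup_dist a b / C by rewrite divr_ge0 ?sup_dist_ge0 // ltW.
have abeta j : `|a j - b j| <= C * (sup_dist a b / C).
  by rewrite mulrC divfK ?gt_eqF // dist_le_sup.
have k0 : 0 <= 2 * n%:R + 1 :> R by rewrite addr_ge0 // mulr_ge0.
have := ler_wpM2l k0 (sqvar_l1_dist N aK bK eta0 abeta).
by move/le_trans; apply; rewrite le_eqVlt; apply/orP; left; apply/eqP; ring.
Qed.

Lemma Hn_ge0 n a b : 0 <= Hn rho C n a b.
Proof. by rewrite /Hn le_min ler01 powR_ge0. Qed.

Lemma qn_ge0 n a b : 0 <= qn C n a b.
Proof. exact: sumr_ge0. Qed.

(** From (s - t)^2 <= |s^2 - t^2|, valid for nonnegative s and t, and from the
    limit N to infinity in [moment_gap]. *)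
Lemma dist_le_qn n a b j : spectra rho C a -> spectra rho C b -> (0 < n)%N ->
  (`|a j - b j| / C) ^+ 4 <= qn C n a b + 4 * S_ rho / Num.sqrt n%:R.
Proof.
move=> aK bK n0.
have [x01 xS] := sqvar_unit rho0 rho2 C0 aK.
have [y01 yS] := sqvar_unit rho0 rho2 C0 bK.
apply: (@le_trans _ _ ((sqvar C a j - sqvar C b j) ^+ 2)).
  rewrite -[4%N]/(2 * 2)%N exprM -dist_normalized /sqvar.
  have u0 := normalized_ge0 C0 j aK; have v0 := normalized_ge0 C0 j bK.
  set u := a j / C in u0 *; set v := b j / C in v0 *.
  rewrite -(real_normK (num_real (u ^+ 2 - v ^+ 2))).
  rewrite ler_pXn2r ?nnegrE ?exprn_ge0 // subr_sqr normrM expr2.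
  apply: ler_wpM2l => //; rewrite [leRHS]ger0_norm ?addr_ge0 // ler_norml.
  by apply/andP; split; lra.
apply: (@cvgr_to_ge _ \oo _ R (fun N =>
    moment_dist n N (sqvar C a) (sqvar C b) + 4 * S_ rho / Num.sqrt n%:R)).
  by apply: cvgD; [exact: moment_dist_cvg|exact: cvg_cst].
exists j.+1 => // N /= jN.
exact: (moment_gap n0 jN (sqvar_nonincreasing C0 aK)
  (sqvar_nonincreasing C0 bK) x01 y01 (xS N) (yS N)).
Qed.

Lemma dist_le_Hn n a b j : spectra rho C a -> spectra rho C b -> (0 < n)%N ->
  `|a j - b j| <= C * Hn rho C n a b.
Proof.
move=> aK bK n0; rewrite mulrC -ler_pdivrMr // /Hn le_min; apply/andP; split.
  by rewrite ler_pdivrMr // mul1r spectra_dist_le_C.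
have d0 : 0 <= `|a j - b j| / C by rewrite divr_ge0 // ltW.
have -> : `|a j - b j| / C = ((`|a j - b j| / C) ^+ 4) `^ (1 / 4).
  rewrite -powR_mulrn // -powRrM mul1r divff ?powRr1 //.
apply: ge0_ler_powR; rewrite ?nnegrE ?exprn_ge0 //; last exact: dist_le_qn.
rewrite addr_ge0 ?qn_ge0 // divr_ge0 ?sqrtr_ge0 // mulr_ge0 //.
exact: le_trans (S_ge1 rho0 rho2).
Qed.

End Estimates.

(** * The weak distance and the l^p distance *)

Lemma min_le_powR (R : realType) (theta u v : R) :
  0 <= theta <= 1 -> 0 <= u -> 0 <= v ->
  Num.min u v <= u `^ (1 - theta) * v `^ theta.
Proof.
move=> /andP[t0 t1] u0 v0; have t1' : 0 <= 1 - theta by rewrite subr_ge0.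
have E w : 0 <= w -> w = w `^ (1 - theta) * w `^ theta.
  by move=> w0; rewrite -powRD subrK ?oner_eq0 // powRr1.
have [uv|vu] := leP u v.
  rewrite {1}(E u u0); apply: ler_wpM2l; first exact: powR_ge0.
  by apply: ge0_ler_powR; rewrite ?nnegrE.
rewrite {1}(E v v0); apply: ler_wpM2r; first exact: powR_ge0.
by apply: ge0_ler_powR; rewrite ?nnegrE // ltW.
Qed.

Lemma small_powR (R : realType) (A theta e : R) :
  0 <= A -> 0 < theta -> 0 < e -> exists2 d : R, 0 < d & A * d `^ theta < e.
Proof.
move=> A0 t0 e0; have A1 : 0 < A + 1 by rewrite ltr_wpDl.
exists ((e / (A + 1)) `^ theta^-1); first by rewrite powR_gt0 // divr_gt0.
rewrite -powRrM mulVf ?gt_eqF // powRr1; last by rewrite divr_ge0 // ltW.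
by rewrite mulrA ltr_pdivrMr // mulrC ltr_pM2l // ltrDl.
Qed.

Section Distances.
Context {R : realType}.
Variables rho C : R.
Hypotheses (rho0 : 0 < rho) (rho2 : rho < 2) (C0 : 0 < C).
Implicit Types (a b : nat -> R) (H e r p : R).

Lemma decr_rearr_le (c : nat -> R) k (t : R) : 0 <= t ->
  (forall j, (k <= j)%N -> `|c j| <= t) -> (decr_rearr c k <= t%:E)%E.
Proof.
move=> t0 ct; apply: ereal_inf_lbound; exists t => //; split=> //.
apply: subset_card_le => j /= tj; rewrite ltnNge; apply/negP => /ct.
by rewrite leNgt tj.
Qed.

(** From rank k on, |a_j - b_j| is at most C min(H, (k+1)^(-1/rho)), and the
    weighted geometric mean of weight rho/r of the two bounds absorbs the
    factor (k+1)^(1/r) exactly. *)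
Lemma weak_dist_le r a b H : rho < r -> spectra rho C a -> spectra rho C b ->
  0 <= H -> (forall j, `|a j - b j| <= C * H) ->
  (weak_dist r a b <= (C * H `^ (1 - rho / r))%:E)%E.
Proof.
move=> hr aK bK H0 abH; have r0 : 0 < r := lt_trans rho0 hr.
apply: ge_ereal_sup => _ [k _ <-].
set v := (k.+1%:R : R) `^ (- rho^-1); have v0 : 0 <= v := powR_ge0 _ _.
have k0 : 0 < (k.+1%:R : R) by rewrite ltr0n.
have vk : v `^ (rho / r) = (k.+1%:R `^ r^-1)^-1.
  rewrite /v -powRrM -powRN; congr (_ `^ _).
  by field; rewrite !gt_eqF.
have t0 : 0 <= C * Num.min H v by rewrite mulr_ge0 ?(ltW C0) // le_min H0.
apply: (@le_trans _ _ ((k.+1%:R `^ r^-1)%:E * (C * Num.min H v)%:E)%E).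
  apply: lee_pmul => //.
    by apply: le_ereal_inf_tmp => _ [t [t0' _] <-]; rewrite lee_fin.
  apply: decr_rearr_le => // j kj /=.
  have [_|_] := leP H v; first exact: abH.
  apply: le_trans (spectra_dist_decay j aK bK) _; rewrite ler_pM2l //.
  rewrite /v !powRN lef_pV2 ?posrE ?powR_gt0 ?ltr0n //.
  apply: ge0_ler_powR; rewrite ?nnegrE ?ler0n ?ler_nat ?ltnS //.
  by rewrite invr_ge0 ltW.
rewrite -EFinM lee_fin.
have rr : 0 <= rho / r <= 1.
  by rewrite divr_ge0 ?(ltW rho0) ?(ltW r0) //= ler_pdivrMr // mul1r ltW.
have := min_le_powR rr H0 v0; rewrite vk => mle.
have K0 : 0 < (k.+1%:R : R) `^ r^-1 by rewrite powR_gt0.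
rewrite mulrCA ler_pM2l // mulrC -ler_pdivlMr //.
Qed.

(** The term of index 0 of the supremum is the largest of the |a_j - b_j|. *)
Lemma dist_le_weak_dist r a b (e : R) j : (weak_dist r a b <= e%:E)%E ->
  `|a j - b j| <= e.
Proof.
move=> abe; rewrite -lee_fin; apply: le_trans abe.
apply: le_trans (ereal_sup_ubound _); last by exists 0%N.
rewrite powR1 mul1e; apply: le_ereal_inf_tmp => _ [t [t0 t_] <-].
rewrite lee_fin leNgt; apply/negP => tj.
move: t_; rewrite II0 card_le0 => /eqP t_.
by have : [set j | t < `|a j - b j|] j by []; rewrite t_.
Qed.

Lemma lp_dist_le p a b H : rho < p -> spectra rho C a -> spectra rho C b ->
  0 <= H -> (forall j, `|a j - b j| <= C * H) ->
  (lp_dist p a b <=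
    ((p / (p - rho)) `^ p^-1 * C * H `^ (1 - rho / p))%:E)%E.
Proof.
move=> hp aK bK H0 abH; have p0 : 0 < p := lt_trans rho0 hp.
have pr0 : 0 < p - rho by rewrite subr_gt0.
rewrite /lp_dist Lnorm_counting //.
set B := C `^ p * (p / (p - rho) * H `^ (p - rho)).
have q0 : 0 <= p / (p - rho) by rewrite divr_ge0 // ltW.
have h1 : 0 <= C `^ p := powR_ge0 _ _.
have h2 : 0 <= H `^ (p - rho) := powR_ge0 _ _.
have B0 : 0 <= B := mulr_ge0 h1 (mulr_ge0 q0 h2).
have -> : (p / (p - rho)) `^ p^-1 * C * H `^ (1 - rho / p) = B `^ p^-1.
  rewrite /B (powRM _ h1 (mulr_ge0 q0 h2)) (powRM _ q0 h2).
  rewrite -!(powRrM C) -(powRrM H) divff ?gt_eqF // powRr1 ?(ltW C0) //.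
  by rewrite mulrCA mulrA; congr (_ * _ `^ _); field; rewrite gt_eqF.
rewrite -poweR_EFin; apply: gt0_ler_poweR.
- by rewrite invr_ge0 ltW.
- rewrite in_itv /= leey andbT; apply: nneseries_ge0 => j _ _.
  by rewrite lee_fin powR_ge0.
- by rewrite in_itv /= leey lee_fin B0.
apply: lime_le; first by apply: is_cvg_nneseries => j _ _; exact: poweR_ge0.
apply: nearW => N; rewrite big_mkord.
under eq_bigr do rewrite abse_EFin poweR_EFin.
rewrite sumEFin lee_fin.
have := @sum_powR_le R rho p H N (fun j => `|a j - b j| / C) rho0 hp H0.
move=> Hs; have {}Hs := Hs _ _ _.
have {Hs} : \sum_(j < N) (`|a j - b j| / C) `^ p <=
    p / (p - rho) * H `^ (p - rho).
  apply: Hs => j.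
  - by rewrite divr_ge0 // ltW.
  - by rewrite ler_pdivrMr // mulrC; exact: spectra_dist_decay.
  - by rewrite ler_pdivrMr // mulrC.
move/(ler_wpM2l (powR_ge0 C p)); apply: le_trans.
rewrite mulr_sumr le_eqVlt; apply/orP; left; apply/eqP; apply: eq_bigr => j _.
by rewrite -powRM ?(ltW C0) ?divr_ge0 ?(ltW C0) // mulrC divfK ?gt_eqF.
Qed.

Lemma dist_le_lp_dist p a b (e : R) j : 0 < p -> 0 <= e ->
  (lp_dist p a b <= e%:E)%E -> `|a j - b j| <= e.
Proof.
move=> p0 e0; rewrite /lp_dist Lnorm_counting // => abe.
rewrite -lee_fin; apply: le_trans abe.
have -> : `|a j - b j|%:E = ((`|a j - b j| `^ p)%:E `^ p^-1)%E.
  by rewrite poweR_EFin -powRrM divff ?gt_eqF // powRr1.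
apply: gt0_ler_poweR.
- by rewrite invr_ge0 ltW.
- by rewrite in_itv /= leey lee_fin powR_ge0.
- rewrite in_itv /= leey andbT; apply: nneseries_ge0 => i _ _.
  by rewrite lee_fin powR_ge0.
apply: le_trans (nneseries_lim_ge j.+1 _); last by move=> *; exact: poweR_ge0.
rewrite big_mkord big_ord_recr /= leeDr //.
by apply: sume_ge0 => i _; rewrite lee_fin powR_ge0.
Qed.

End Distances.

(** * Moduli of continuity *)

Section Moduli.
Context {R : realType}.
Variables rho C : R.
Hypotheses (rho0 : 0 < rho) (rho2 : rho < 2) (C0 : 0 < C).
Implicit Types (a b : nat -> R) (e r p : R).

(** The limit of [esym_dist] along truncations. *)
Definition coef_dist m a b : R :=
  \sum_(k < m) `|elem_coefs C a k - elem_coefs C b k|.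

Lemma esym_dist_cvg m a b : spectra rho C a -> spectra rho C b ->
  esym_dist m N (sqvar C a) (sqvar C b) @[N --> \oo] --> coef_dist m a b.
Proof.
move=> aK bK; apply: cvg_big => [|k _]; first exact: add_continuous.
have [x01 xS] := sqvar_unit rho0 rho2 C0 aK.
have [y01 yS] := sqvar_unit rho0 rho2 C0 bK.
have x0 j : 0 <= sqvar C a j by have /andP[] := x01 j.
have y0 j : 0 <= sqvar C b j by have /andP[] := y01 j.
by apply: cvg_norm; apply: cvgB; [exact: esym_cvg xS|exact: esym_cvg yS].
Qed.

(** Limit of [moment_dist_esym] along truncations. *)
Lemma qn_le_coef_dist n : exists2 L : R, 0 <= L &
  forall a b, spectra rho C a -> spectra rho C b ->
  qn C n a b <= L * coef_dist n.+1 a b.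
Proof.
have [L L0 HL] := moment_dist_esym (S_ge1 rho0 rho2) n.
exists L => // a b aK bK.
have xU := sqvar_unit rho0 rho2 C0 aK; have yU := sqvar_unit rho0 rho2 C0 bK.
have cv : L * esym_dist n.+1 N (sqvar C a) (sqvar C b) @[N --> \oo] -->
    L * coef_dist n.+1 a b.
  by apply: cvgM; [exact: cvg_cst|exact: esym_dist_cvg].
apply: (ler_cvg_to (moment_dist_cvg rho0 rho2 C0 aK bK) cv).
by apply: nearW => N; exact: HL.
Qed.

Lemma elem_coefs_modulus k e : 0 < e -> exists2 d : R, 0 < d &
  forall a b, spectra rho C a -> spectra rho C b ->
  (forall j, `|a j - b j| <= d) -> `|elem_coefs C a k - elem_coefs C b k| < e.
Proof.
move=> e0; set S := S_ rho : R.
have S0 : 0 <= S := le_trans ler01 (S_ge1 rho0 rho2).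
pose A := k.+1%:R * S ^+ k * (2 * S).
have A0 : 0 <= A by apply: mulr_ge0; rewrite mulr_ge0 ?exprn_ge0.
have t0 : 0 < 1 - rho / 2 by rewrite subr_gt0 ltr_pdivrMr // mul1r.
have [d d0 Ad] := small_powR A0 t0 e0.
exists (C * d) => [|a b aK bK abd]; first by rewrite mulr_gt0.
apply: le_lt_trans Ad.
have [x01 xS] := sqvar_unit rho0 rho2 C0 aK.
have [y01 yS] := sqvar_unit rho0 rho2 C0 bK.
have x0 j : 0 <= sqvar C a j by have /andP[] := x01 j.
have y0 j : 0 <= sqvar C b j by have /andP[] := y01 j.
have cv : `|esym N k.+1 (sqvar C a) - esym N k.+1 (sqvar C b)| @[N --> \oo]
    --> `|elem_coefs C a k - elem_coefs C b k|.
  by apply: cvg_norm; apply: cvgB; [exact: esym_cvg xS|exact: esym_cvg yS].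
apply: (cvgr_to_le cv); apply: nearW => N.
have D M := sqvar_l1_dist rho0 rho2 C0 M aK bK (ltW d0) abd.
have := esym_lipschitz N k.+1 x0 y0 xS yS D.
by rewrite /A -!mulrA.
Qed.

(** First choose n so large that 4 S_rho / sqrt n is negligible; the finitely
    many coefficients of index at most n then control q_n. *)
Lemma elem_coefs_inverse_modulus e : 0 < e ->
  exists m, exists2 d : R, 0 < d &
  forall a b, spectra rho C a -> spectra rho C b ->
  (forall k, (k < m)%N -> `|elem_coefs C a k - elem_coefs C b k| < d) ->
  forall j, `|a j - b j| <= e.
Proof.
move=> e0; set S := S_ rho : R.
have S0 : 0 <= S := le_trans ler01 (S_ge1 rho0 rho2).
pose g := (e / C) ^+ 4; have g0 : 0 < g by rewrite exprn_gt0 // divr_gt0.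
(* n > M^2 makes the error term 4 S / sqrt n at most g / 2 *)
pose M := 8 * S / g.
have M0 : 0 <= M by apply: divr_ge0; [exact: mulr_ge0|exact: ltW].
pose n := Num.bound (M ^+ 2).
have nM : M ^+ 2 < n%:R by apply: archi_boundP; exact: exprn_ge0.
have n0 : (0 < n)%N.
  by rewrite -(ltr0n R); apply: le_lt_trans nM; exact: exprn_ge0.
have q0 : 0 < Num.sqrt (n%:R : R) by rewrite sqrtr_gt0 ltr0n.
have Mq : M <= Num.sqrt n%:R.
  by rewrite -(ger0_norm M0) -sqrtr_sqr ler_wsqrtr // ltW.
have [L L0 HL] := qn_le_coef_dist n.
have Ln0 : 0 < L * n.+1%:R + 1 by rewrite ltr_wpDl // mulr_ge0.
pose d := g / 2 / (L * n.+1%:R + 1).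
have d0 : 0 < d by rewrite !divr_gt0.
exists n.+1; exists d => // a b aK bK abd j.
have := dist_le_qn rho0 rho2 C0 j aK bK n0.
have h1 : qn C n a b <= g / 2.
  apply: le_trans (HL a b aK bK) _.
  have cd : coef_dist n.+1 a b <= n.+1%:R * d.
    rewrite mulr_natl -[n.+1 in leRHS]card_ord -sumr_const.
    by apply: ler_sum => k _; exact/ltW/abd.
  apply: le_trans (ler_wpM2l L0 cd) _.
  rewrite mulrA /d mulrA ler_pdivrMr // mulrC ler_pM2l ?divr_gt0 //.
  by rewrite lerDl.
have h2 : 4 * S / Num.sqrt n%:R <= g / 2.
  rewrite ler_pdivrMr //; have := ler_wpM2l (ltW g0) Mq.
  have -> : g * M = 8 * S by rewrite /M; field; rewrite gt_eqF.
  by lra.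
move=> H; have {H} H : (`|a j - b j| / C) ^+ 4 <= (e / C) ^+ 4.
  by apply: le_trans H _; rewrite -/S -/g; lra.
move: H; rewrite ler_pXn2r ?nnegrE ?divr_ge0 ?(ltW C0) ?(ltW e0) //.
by rewrite ler_pM2r // invr_gt0.
Qed.

Lemma weak_dist_modulus r e : rho < r -> 0 < e -> exists2 d : R, 0 < d &
  forall a b, spectra rho C a -> spectra rho C b ->
  (forall j, `|a j - b j| <= d) -> (weak_dist r a b < e%:E)%E.
Proof.
move=> hr e0; have r0 : 0 < r := lt_trans rho0 hr.
have t0 : 0 < 1 - rho / r by rewrite subr_gt0 ltr_pdivrMr // mul1r.
have [d d0 Ad] := small_powR (ltW C0) t0 e0.
exists (C * d) => [|a b aK bK abd]; first by rewrite mulr_gt0.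
apply: le_lt_trans (weak_dist_le rho0 C0 hr aK bK (ltW d0) abd) _.
by rewrite lte_fin.
Qed.

Lemma lp_dist_modulus p e : rho < p -> 0 < e -> exists2 d : R, 0 < d &
  forall a b, spectra rho C a -> spectra rho C b ->
  (forall j, `|a j - b j| <= d) -> (lp_dist p a b < e%:E)%E.
Proof.
move=> hp e0; have p0 : 0 < p := lt_trans rho0 hp.
have t0 : 0 < 1 - rho / p by rewrite subr_gt0 ltr_pdivrMr // mul1r.
have A0 : 0 <= (p / (p - rho)) `^ p^-1 * C.
  by rewrite mulr_ge0 ?powR_ge0 // ltW.
have [d d0 Ad] := small_powR A0 t0 e0.
exists (C * d) => [|a b aK bK abd]; first by rewrite mulr_gt0.
apply: le_lt_trans (lp_dist_le rho0 C0 hp aK bK (ltW d0) abd) _.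
by rewrite lte_fin.
Qed.

(** The decay rate is common to the class, so the rank N serves all its
    members. *)
Lemma spectra_tail e : 0 < e -> exists N, forall a j, spectra rho C a ->
  (N <= j)%N -> a j <= e.
Proof.
move=> e0; pose M := (C / e) `^ rho.
exists (Num.bound M) => a j [_ _ aC] Nj; apply: le_trans (aC j) _.
have Mj : M <= j.+1%:R.
  apply: (@le_trans _ _ (Num.bound M)%:R).
    by apply/ltW/archi_boundP; exact: powR_ge0.
  by rewrite ler_nat leqW.
have ri : 0 <= rho^-1 by rewrite invr_ge0 ltW.
have := ge0_ler_powR ri (powR_ge0 _ _ : M \in Num.nneg)
  (ler0n R j.+1 : _ \in Num.nneg) Mj.
rewrite /M -powRrM divff ?gt_eqF // powRr1; last by rewrite divr_ge0 // ltW.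
by rewrite powRN ler_pdivrMr ?powR_gt0 // ler_pdivrMr // mulrC.
Qed.

(** Uniform and pointwise closeness agree on the class: beyond a common rank
    both sequences are small. *)
Lemma pointwise_modulus e : 0 < e -> exists N,
  forall a b, spectra rho C a -> spectra rho C b ->
  (forall j, (j < N)%N -> `|a j - b j| <= e) -> forall j, `|a j - b j| <= e.
Proof.
move=> e0; have [N HN] := spectra_tail e0; exists N => a b aK bK abe j.
have [jN|Nj] := ltnP j N; first exact: abe.
have := HN a j aK Nj; have := HN b j bK Nj.
have [_ /(_ j) ? _] := aK; have [_ /(_ j) ? _] := bK.
by move=> ? ?; rewrite ler_norml; apply/andP; split; lra.
Qed.

(** Truncate at the rank of [spectra_tail]. *)
Lemma fin_spectra_dense a e : spectra rho C a -> 0 < e ->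
  exists2 b, fin_spectra rho C b & forall j, `|a j - b j| <= e.
Proof.
move=> aK e0; have [N HN] := spectra_tail e0; have [ad a0 aC] := aK.
exists (fun j => if (j < N)%N then a j else 0); last first.
  move=> j; case: ltnP => [jN|Nj]; first by rewrite subrr normr0 ltW.
  by rewrite subr0 ger0_norm // HN.
split; last first.
  apply: (sub_finite_set _ (finite_II N)) => j /=.
  by case: ltnP => //; rewrite eqxx.
split=> [m n mn|j|j].
- case: (ltnP n N) => [nN|Nn]; first by rewrite (leq_ltn_trans mn nN) ad.
  by case: ifP.
- by case: ifP.
- by case: ifP => // _; rewrite mulr_ge0 ?powR_ge0 // ltW.
Qed.

End Moduli.

(** * Uniform spaces *)

(** An injective uniformly continuous map is a uniform isomorphism onto its
    range as soon as every entourage of the source contains the preimage of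
    one of the target. *)
Lemma unif_iso_onto_inj (X Y : uniformType) (f : X -> Y) (B : set Y) :
  range f = B -> injective f -> unif_continuous f ->
  (forall E, entourage E -> exists2 D, entourage D &
     forall x y, D (f x, f y) -> E (x, y)) ->
  unif_iso_onto f B.
Proof.
move=> fB finj fc fi.
have Bf x : f x \in B by apply/mem_set; rewrite -fB; exists x.
have surj (y : set_type B) : exists x, f x = set_val y.
  have sB : B `<=` range f by rewrite fB.
  by have [x _ ?] := sB _ (set_valP y); exists x.
pose g x : set_type B := exist _ (f x) (Bf x).
pose h y := projT1 (cid (surj y)).
have hE y : f (h y) = set_val y by rewrite /h; case: cid.
exists g => //; exists h; split.
- by move=> x; apply: finj; rewrite hE.
- by move=> y; apply: val_inj; rewrite /= hE.
- move=> E [V entV VE].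
  have H : entourage ((fun xy => (f xy.1, f xy.2)) @^-1` V) := fc V entV.
  suff : entourage ((fun xy => (g xy.1, g xy.2)) @^-1` E) by [].
  by apply: filterS H => -[x y] /= Vxy; exact: VE.
- move=> E /fi[D entD DE]; exists D => // -[x y] /= Dxy.
  by apply: DE; rewrite !hE.
Qed.

(** A cluster point of a Cauchy filter is a limit of it. *)
Lemma compact_complete_space (X : uniformType) :
  compact [set: X] -> complete_space X.
Proof.
move=> cX F PF cF; have [x [_ clx]] := cX F PF filterT.
exists x; apply/cvg_entourageP => E entE.
have [[D1 D2] /= [FD1 FD2] D12] := cF _ (entourage_split_ent entE).
have [z [Dz /xsectionP xz]] := clx _ _ FD1
  (nbhs_entourage x (entourage_split_ent entE)).
apply: filterS FD2 => t Dt.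
by apply: (entourage_split z entE xz); exact: (D12 (z, t)).
Qed.

Lemma subfun_unif_iso_onto (X : uniformType) (A B : set X) (AB : A `<=` B) :
  unif_iso_onto (subfun AB : set_type A -> set_type B) (range (subfun AB)).
Proof.
apply: unif_iso_onto_inj => //.
  move=> E [V entV VE]; exists V => // -[x y] /= Vxy.
  exact: VE.
move=> E [V entV VE]; exists [set xy | V (set_val xy.1, set_val xy.2)].
  by exists V.
by move=> x y Vxy; apply: VE.
Qed.

Section PointwiseUniformity.
Context {R : realType}.

(** Basic entourages of the product uniformity: closeness of finitely many
    coordinates. *)
Definition ptws_ball m (d : R) : set ({ptws nat -> R} * {ptws nat -> R}) :=
  [set uv | forall k, (k < m)%N -> `|uv.1 k - uv.2 k| < d].

Lemma ptws_entourageP (D : set ({ptws nat -> R} * {ptws nat -> R})) :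
  entourage D <-> exists m, exists2 d, 0 < d & ptws_ball m d `<=` D.
Proof.
(* intersections of finitely many basic entourages are handled by a filter *)
pose G : set_system ({ptws nat -> R} * {ptws nat -> R}) :=
  filter_from [set md : nat * R | 0 < md.2] (fun md => ptws_ball md.1 md.2).
have GF : Filter G.
  apply: filter_from_filter; first by exists (0%N, 1) => /=.
  move=> [m d] [m' d'] /= d0 d0'; exists (maxn m m', Num.min d d') => /=.
    by rewrite lt_min d0.
  move=> uv H; split=> k km; have := H k; rewrite /= leq_max km ?orbT;
    by move=> /(_ isT); rewrite lt_min => /andP[].
have coord k (d : R) : 0 < d -> entourage
    [set uv : {ptws nat -> R} * {ptws nat -> R} | `|uv.1 k - uv.2 k| < d].
  move=> d0.
  pose V : set (R * R) := [set xy | `|xy.1 - xy.2| < d].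
  have entV : entourage V by rewrite -entourage_ballE; exists d.
  pose T (i : nat) := initial_topology (@proj nat (fun=> R) i).
  have ent : @entourage (T k) [set uv | V (uv.1 k, uv.2 k)].
    by exists V.
  have /asboolP ent' := ent.
  exists [set uv | V (uv.1 k, uv.2 k)] => //.
  exists [fset (exist _ (k : {classic nat}, _) ent')]%fset.
    by move=> p _; rewrite in_setT.
  apply/seteqP; split=> [uv H|uv H p /=]; last by rewrite inE => /eqP ->.
  exact: (H _ (fset11 _)).
split=> [[_ [F _ <-] FD]|[m [d d0 mD]]].
  have : G D.
    apply: filterS FD _; apply: filter_bigI => -[[i E] /= iE] _.
    move/asboolP : (iE) => [V entV VE].
    move: entV; rewrite -entourage_ballE => -[d /= d0 dV].
    exists (i.+1, d) => // uv uvd; apply: VE; apply: dV.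
    exact: (uvd i (ltnSn i)).
  by move=> [[m d] d0 mD]; exists m; exists d.
apply: filterS mD _; elim: m => [|m IH].
  by apply: filterS filterT => uv _ k.
apply: filterS (filterI IH (coord m d d0)) => uv [uvm uvd] k.
by rewrite ltnS leq_eqVlt => /predU1P[->|/uvm].
Qed.

End PointwiseUniformity.

(** * The uniformity of the class *)

Lemma open_entourageP (X : uniformType) (U : set X) :
  open U <-> forall x, U x ->
    exists2 E, entourage E & forall y, E (x, y) -> U y.
Proof.
rewrite openE; split=> H x Ux.
  have /nbhsP[E entE EU] := H x Ux; exists E => // y Exy.
  by apply: EU; apply/xsectionP.
have [E entE EU] := H x Ux; apply/nbhsP; exists E => // y /xsectionP.
exact: EU.
Qed.

Lemma unif_continuous_continuous (X Y : uniformType) (f : X -> Y) :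
  unif_continuous f -> continuous f.
Proof.
move=> fc x U /nbhsP[E entE EU]; apply/nbhsP.
exists ((fun xy => (f xy.1, f xy.2)) @^-1` E).
  exact: fc.
by move=> y /xsectionP xy; apply: EU; apply/xsectionP.
Qed.

Section SupUniformity.
Context {R : realType}.
Variables rho C : R.
Hypotheses (rho0 : 0 < rho) (rho2 : rho < 2) (C0 : 0 < C).

Local Notation K := (spectra rho C).

(** The uniformity of the supremum distance on the class, with which those of
    d_r, of l^p and of the coefficient map are compared. *)
Definition sup_entourage (E : set (set_type K * set_type K)) : Prop :=
  exists2 e : R, 0 < e & forall a b : set_type K,
    (forall j, `|set_val a j - set_val b j| <= e) -> E (a, b).

Lemma qdist_entourageP (q : quasi_dist R (nat -> R)) :
  (forall e, 0 < e -> exists2 d : R, 0 < d & forall a b, K a -> K b ->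
    (forall j, `|a j - b j| <= d) -> (q a b < e%:E)%E) ->
  (forall e : R, 0 < e -> forall a b, (q a b < e%:E)%E ->
    forall j, `|a j - b j| <= e) ->
  forall E : set (set_type (K : set (qdist_space q)) *
                  set_type (K : set (qdist_space q))),
  entourage E <-> sup_entourage E.
Proof.
move=> q_small q_large E; split=> [[V [e /= e0 eV] VE]|[e e0 eE]].
  have [d d0 H] := q_small e e0; exists d => // a b abd.
  by apply: VE; apply: eV; apply: H => //; exact: set_valP.
exists [set xy : qdist_space q * qdist_space q | (q xy.1 xy.2 < e%:E)%E].
  by exists e.
by move=> [a b] /= qab; apply: eE; exact: q_large.
Qed.

Lemma weak_entourageP r (hr : rho < r)
  (E : set (set_type (K : set (qdist_space (weak_qdist (lt_trans rho0 hr)))) *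
            set_type (K : set (qdist_space (weak_qdist (lt_trans rho0 hr)))))) :
  entourage E <-> sup_entourage E.
Proof.
apply: qdist_entourageP => e e0; first exact: weak_dist_modulus.
by move=> a b /ltW abe j; exact: dist_le_weak_dist abe.
Qed.

Lemma lp_entourageP p (hp : 1 <= p) (rp : rho < p)
  (E : set (set_type (K : set (qdist_space (lp_qdist hp))) *
            set_type (K : set (qdist_space (lp_qdist hp))))) :
  entourage E <-> sup_entourage E.
Proof.
apply: qdist_entourageP => e e0; first exact: lp_dist_modulus.
move=> a b /ltW abe j; apply: dist_le_lp_dist abe; last exact: ltW.
exact: (lt_le_trans ltr01 hp).
Qed.

Lemma coefs_ball_modulus m (d : R) : 0 < d -> exists2 e : R, 0 < e &
  forall a b, K a -> K b -> (forall j, `|a j - b j| <= e) ->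
  @ptws_ball R m d (elem_coefs C a, elem_coefs C b).
Proof.
move=> d0; elim: m => [|m [e e0 IH]]; first by exists 1.
have [e' e0' He'] := elem_coefs_modulus rho0 rho2 C0 m d0.
exists (Num.min e e') => [|a b aK bK abe k]; first by rewrite lt_min e0.
rewrite ltnS leq_eqVlt => /predU1P[->|km].
  apply: He' => // j; apply: le_trans (abe j) _.
  by rewrite ge_min lexx orbT.
apply: IH => // j; apply: le_trans (abe j) _.
by rewrite ge_min lexx.
Qed.

Lemma coefs_entourageP
  (J := (fun a : set_type K => elem_coefs C (set_val a)))
  (E : set (initial_topology J * initial_topology J)) :
  entourage E <-> sup_entourage E.
Proof.
split=> [[V /ptws_entourageP[m [d d0 dV]] VE]|[e e0 eE]].
  have [e e0 He] := coefs_ball_modulus m d0; exists e => // a b abe.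
  by apply: VE; apply: dV; apply: He => //; exact: set_valP.
have [m [d d0 Hd]] := elem_coefs_inverse_modulus rho0 rho2 C0 e0.
exists (@ptws_ball R m d); first by apply/ptws_entourageP; exists m; exists d.
by move=> [a b] /= ab; apply: eE; apply: Hd => //; exact: set_valP.
Qed.

Lemma spectra_sep (a b : set_type K) :
  (forall e : R, 0 < e -> forall j, `|set_val a j - set_val b j| <= e) -> a = b.
Proof.
move=> abe; apply: val_inj; apply/funext => j.
apply/eqP; rewrite -subr_eq0 -normr_le0; apply/ler_addgt0Pr => e e0.
by rewrite add0r; exact: abe.
Qed.

Lemma coefs_injective :
  injective (fun a : set_type K => elem_coefs C (set_val a)).
Proof.
move=> a b ab; apply: spectra_sep => e e0.
have [m [d d0 Hd]] := elem_coefs_inverse_modulus rho0 rho2 C0 e0.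
apply: Hd => [||k _]; [exact: set_valP|exact: set_valP|].
by rewrite ab subrr normr0.
Qed.

Section Weak.
Variable r : R.
Hypothesis hr : rho < r.
Let Kr : set (qdist_space (weak_qdist (lt_trans rho0 hr))) := K.
Let J : set_type Kr -> {ptws nat -> R} := fun a => elem_coefs C (set_val a).

Lemma coefs_unif_continuous : unif_continuous J.
Proof.
move=> V /ptws_entourageP[m [d d0 dV]].
have [e e0 He] := coefs_ball_modulus m d0.
suff : entourage ((fun xy => (J xy.1, J xy.2)) @^-1` V) by [].
apply/weak_entourageP; exists e => // a b abe.
by apply: dV; apply: He => //; exact: set_valP.
Qed.

Lemma coefs_unif_iso_onto B : range J = B -> unif_iso_onto J B.
Proof.
move=> JB; apply: unif_iso_onto_inj => //.
- exact: coefs_injective.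
- exact: coefs_unif_continuous.
move=> E /weak_entourageP[e e0 eE].
have [m [d d0 Hd]] := elem_coefs_inverse_modulus rho0 rho2 C0 e0.
exists (@ptws_ball R m d); first by apply/ptws_entourageP; exists m; exists d.
by move=> a b ab; apply: eE; apply: Hd => //; exact: set_valP.
Qed.

(** Along an ultrafilter each coordinate, confined to [0, C], converges. The
    conditions defining the class are closed and pass to the limit sequence,
    and convergence of the coordinates is convergence for d_r by
    [pointwise_modulus]. *)
Lemma spectra_compact : compact [set: set_type Kr].
Proof.
rewrite compact_ultra => F FU _.
have coord j : exists p : R, (fun a : set_type Kr => set_val a j) @ F --> p.
  pose g (a : set_type Kr) : R := set_val a j.
  have gC : (g @ F) `[0, C]%classic.
    suff gT : g @^-1` `[0, C]%classic = [set: set_type Kr].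
      have : F (g @^-1` `[0, C]%classic) by rewrite gT; exact: filterT.
      by [].
    apply/seteqP; split=> // a _ /=; rewrite in_itv /=.
    have [_ a0 aC] := set_valP a; rewrite /g a0 /=.
    apply: le_trans (aC j) _.
    by rewrite ler_piMr ?(ltW C0) // powR_decay_le1.
  have [p [_ clp]] := @segment_compact R 0 C (g @ F) _ gC.
  exists p; apply/cvgrPdist_le => e e0.
  have [//|nF] := in_ultra_setVsetC [set a | `|p - g a| <= e] FU.
  have [x [/= nx xe]] := clp _ _ (nF : (g @ F) [set x | ~ `|p - x| <= e])
    (nbhsx_ballx p e e0).
  by exfalso; apply: nx; apply: ltW.
pose p j := projT1 (cid (coord j)).
have pE j : (fun a : set_type Kr => set_val a j) @ F --> p j.
  by rewrite /p; case: cid.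
have pK : K p.
  split=> [m n mn|j|j].
  - apply: (ler_cvg_to (pE n) (pE m)); apply: nearW => a.
    by have [ad _ _] := set_valP a; exact: ad.
  - by apply: (cvgr_to_ge (pE j)); apply: nearW => a;
    have [_ a0 _] := set_valP a; exact: a0.
  - by apply: (cvgr_to_le (pE j)); apply: nearW => a;
    have [_ _ aC] := set_valP a; exact: aC.
exists (exist _ p (mem_set pK) : set_type Kr); split=> //.
apply/cvg_entourageP => E /weak_entourageP[e e0 eE].
have [N HN] := pointwise_modulus rho0 C0 e0.
have near N' : F [set a | forall j, (j < N')%N -> `|p j - set_val a j| <= e].
  elim: N' => [|N' IH]; first by apply: (filterS _ (filterT : F setT)).
  have /cvgrPdist_le/(_ e e0) H := pE N'.
  apply: filterS (filterI IH H) => a [a1 a2] j.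
  by rewrite ltnS leq_eqVlt => /predU1P[->//|/a1].
apply: filterS (near N) => a ap; apply: eE => j /=.
by apply: HN => //; exact: set_valP.
Qed.

Lemma spectra_hausdorff : hausdorff_space (set_type Kr).
Proof.
move=> a b clab; apply: spectra_sep => e e0 j.
pose E := [set xy : set_type Kr * set_type Kr |
  forall j, `|set_val xy.1 j - set_val xy.2 j| <= e / 2].
have entE : entourage E.
  by apply/weak_entourageP; exists (e / 2); rewrite ?divr_gt0.
have [c [/xsectionP ac /xsectionP bc]] :=
  clab _ _ (nbhs_entourage a entE) (nbhs_entourage b entE).
have := lerD (ac j) (bc j); rewrite /= -splitr; apply: le_trans.
rewrite (distrC (set_val b j)); apply: le_trans (ler_normD _ _).
by rewrite subrKA.
Qed.

Let Kfin : set (qdist_space (weak_qdist (lt_trans rho0 hr))) :=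
  fin_spectra rho C.

Lemma fin_spectra_range_dense :
  dense (range (subfun (@subIsetl _ _ _) : set_type Kfin -> set_type Kr)).
Proof.
move=> O [a Oa] /open_entourageP /(_ a Oa)[E /weak_entourageP[e e0 eE] EO].
have [b bfin ab] := fin_spectra_dense rho0 C0 (set_valP a) e0.
pose b' : set_type Kfin := exist _ b (mem_set bfin).
exists (subfun (@subIsetl _ _ _) b'); split; last by exists b'.
exact/EO/eE.
Qed.

(** J(K) is compact, hence closed, and J(K^fin) is dense in it. *)
Lemma closure_fin_coefs :
  range J = closure (elem_coefs C @` fin_spectra rho C : set {ptws nat -> R}).
Proof.
apply/seteqP; split=> [_ [a _ <-] U|].
  move=> /nbhsP[E /ptws_entourageP[m [d d0 dE]] EU].
  have [e e0 He] := coefs_ball_modulus m d0.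
  have [b bfin ab] := fin_spectra_dense rho0 C0 (set_valP a) e0.
  exists (elem_coefs C b); split; first by exists b.
  apply: EU; apply/xsectionP; apply: dE; apply: He => //; first exact: set_valP.
  by case: bfin.
have cl : closed (range J).
  apply: compact_closed.
    by apply: hausdorff_product => _; exact: Rhausdorff.
  apply: continuous_compact; last exact: spectra_compact.
  exact/continuous_subspaceT/unif_continuous_continuous/coefs_unif_continuous.
rewrite [X in _ `<=` X](closure_id _).1 //; apply: closureS => _ [b [bK _] <-].
by exists (exist _ b (mem_set bK)).
Qed.

End Weak.
End SupUniformity.

Unset Implicit Arguments.
Set Strict Implicit.

Theorem theorem10p7 (R : realType) (rho C r : R)
    (hrho0 : 0 < rho) (hrho2 : rho < 2) (hC : 0 < C) (hr : rho < r) :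
  let K : set (qdist_space (weak_qdist (lt_trans hrho0 hr))) := spectra rho C in
  let Kfin : set (qdist_space (weak_qdist (lt_trans hrho0 hr))) := fin_spectra rho C in
  let J : set_type K -> {ptws nat -> R} := fun a => elem_coefs C (set_val a) in
  let Jfin : set {ptws nat -> R} := elem_coefs C @` fin_spectra rho C in
  [/\ forall (a b : nat -> R) (n : nat),
        spectra rho C a -> spectra rho C b -> (0 < n)%N ->
        (weak_dist r a b <= (C * Hn rho C n a b `^ (1 - rho / r))%:E)%E /\
        qn C n a b <= 2 * (2 * n%:R + 1) * S_ rho *
                        (sup_dist a b / C) `^ (1 - rho / 2),
      unif_iso_onto J (range J),
      compact [set: set_type K] /\ complete_space (set_type K),
      is_completion (subfun (@subIsetl _ _ _) : set_type Kfin -> set_type K) /\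
        unif_iso_onto J (closure Jfin)
    & forall (p : R) (hp1 : 1 <= p), rho < p ->
        let Kp : set (qdist_space (lp_qdist hp1)) := spectra rho C in
        (forall U : set (set_type (spectra rho C)),
           open (U : set (initial_topology J)) <->
           open (U : set (set_type Kp))) /\
        (forall (a b : nat -> R) (n : nat),
           spectra rho C a -> spectra rho C b -> (0 < n)%N ->
           (lp_dist p a b <= ((p / (p - rho)) `^ p^-1 * C *
                               Hn rho C n a b `^ (1 - rho / p))%:E)%E)].
Proof.
move=> K Kfin J Jfin; split.
- move=> a b n aK bK n0; split; last exact: qn_le.
  apply: weak_dist_le => //; first exact: Hn_ge0.
  by move=> j; exact: dist_le_Hn.
- exact: coefs_unif_iso_onto.
- have Kc : compact [set: set_type K] by exact: spectra_compact.
  by split=> //; exact: compact_complete_space.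
- split; last first.
    by apply: coefs_unif_iso_onto => //; exact: closure_fin_coefs.
  split.
  + exact/compact_complete_space/spectra_compact.
  + exact: spectra_hausdorff.
  + exact: subfun_unif_iso_onto.
  + exact: fin_spectra_range_dense.
move=> p hp1 rp Kp; split=> [U|a b n aK bK n0]; last first.
  apply: lp_dist_le => //; first exact: Hn_ge0.
  by move=> j; exact: dist_le_Hn.
(* both sides are open for the uniformity of the supremum distance *)
split=> /open_entourageP HU; apply/open_entourageP => a Ua;
  have [E entE EU] := HU a Ua; exists E => //.
- by apply/lp_entourageP => //; apply/coefs_entourageP.
- by apply/coefs_entourageP => //; apply/lp_entourageP.
Qed.
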